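(* Let $P$ be a homologically admissible poset and let $M'$ be a Morse matching on $P$ such that the family $\mathcal{R}_{M'}(P)$ of equivalence classes of rays in $\mathcal{H}_{M'}(P)$ is finite. Let $m_n$ denote the number of critical elements of $P$ of degree $n$ (with respect to $M'$), let $r_n$ denote the number of equivalence classes of rays of degree $n$ in $\mathcal{H}_{M'}(P)$, and let $b_n$ be the $n$-th Betti number of $P$. Then for all $N\in\mathbb{N}$: 1. $\sum_{i\leq N} (-1)^{N-i} (m_i+r_i)\geq \sum_{i\leq N} (-1)^{N-i} b_i$, provided that all $m_i$ are finite for $i\leq N$; 2. $b_N\leq m_N+r_N$; 3. $\sum_{i=0}^{\infty} (-1)^i b_i=\sum_{i=0}^{\infty} (-1)^i (m_i+r_i)$, provided that all $m_i$ are finite and all but finitely many $m_i$ are zero.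
   Context: Here $\mathbb{N}=\{0,1,2,\dots\}$. For a poset $P$ and $x\in P$ write $x\!\downarrow=\{y\in P: y\le x\}$ and $\hat{x}\!\downarrow=x\!\downarrow\smallsetminus\{x\}$. The length of a finite chain with $n+1$ elements is $n$. $P$ is graded if for every $x\in P$ all maximal chains in $x\!\downarrow$ are finite and have the same length, called $\deg(x)$. $P$ has finite principal ideals if $x\!\downarrow$ is finite for every $x$. The order complex $\mathcal{K}(P)$ is the (geometric realization of the) simplicial complex of finite nonempty chains of $P$. The $n$-th Betti number of $P$ is the rank of $H_n(\mathcal{K}(P);\mathbb{Z})$ (possibly infinite). $P$ is homologically admissible if it is graded, has finite principal ideals, and for all $x\in P$ and every maximal element $y$ of $\hat{x}\!\downarrow$ the complex $\mathcal{K}(\hat{x}\!\downarrow\smallsetminus\{y\})$ is (nonempty and) connected with $H_n(\mathcal{K}(\hat{x}\!\downarrow\smallsetminus\{y\}))=0$ for all $n\ge 1$. The Hasse diagram $\mathcal{H}(P)$ is the digraph with vertex set $P$ and an arrow from $x$ to $y$ whenever $x$ covers $y$. A matching $M$ on $\mathcal{H}(P)$ is a set of arrows no two of which share a vertex; $\mathcal{H}_M(P)$ is obtained from $\mathcal{H}(P)$ by reversing the arrows in $M$. $M$ is a Morse matching if $\mathcal{H}_M(P)$ has no directed cycles. An element is critical if it belongs to no arrow of $M$. A ray in a digraph is an infinite sequence $x_0,x_1,\dots$ of pairwise distinct vertices with an arrow from $x_i$ to $x_{i+1}$ for all $i$. Two rays $r,s$ are equivalent if there are $K,N\in\mathbb{N}$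 with $r_{K+i}=s_{N+i}$ for all $i\in\mathbb{N}$. $\mathcal{R}_M(P)$ is the set of equivalence classes of rays in $\mathcal{H}_M(P)$. The degree of a ray $r$ in $\mathcal{H}_M(P)$ is $\min_j\deg(r_j)$ (equivalent rays have the same degree). *)

(* Defs.v *)
From HB Require Import structures.
From mathcomp Require Import all_boot all_order all_algebra.
From mathcomp Require Import finmap generic_quotient ring_quotient freeg.
From mathcomp Require Import boolp classical_sets functions cardinality fsbigop.
From mathcomp Require Import constructive_ereal ereal.

Set Implicit Arguments.
Unset Strict Implicit.
Unset Printing Implicit Defensive.

Import Order.TTheory GRing.Theory Num.Theory.

Local Open Scope classical_set_scope.
Local Open Scope order_scope.

(* Possibly infinite numbers take their values in [\bar int]: a nonnegative
   integer or [+oo].  All infinite cardinalities are identified with [+oo]. *)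

Definition ecard (T : choiceType) (A : set T) : \bar int :=
  if `[< finite_set A >] then (#|` fset_set A |)%:Z%:E%E else +oo%E.

Definition Zindep (A : zmodType) (k : nat) (v : 'I_k -> A) : Prop :=
  forall c : 'I_k -> int, (\sum_i v i *~ c i = 0 -> forall i, c i = 0)%R.

(* The torsion-free rank; [k = 0] is always allowed, so it is nonnegative. *)
Definition rank (A : zmodType) : \bar int :=
  supremum -oo%E [set (k%:Z%:E)%E | k in [set k | exists v : 'I_k -> A, Zindep v]].

Section OrderComplex.
Context {d : Order.disp_t} {P : porderType d}.
Implicit Types (A : set P) (x y : P).

(* The order complex of the subposet [A] of [P].  Each of its n-simplices is a
   chain with n+1 elements, listed in increasing order; the simplicial homology
   below is computed with the orientations given by this order. *)

Definition is_simplex A n : pred (seq P) :=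
  fun s => [&& size s == n.+1, sorted <%O s & all (fun x => x \in A) s].

Definition simplex A n : Type := {s : seq P | is_simplex A n s}.
HB.instance Definition _ A n := Choice.on (simplex A n).

Lemma face_subproof A n (i : 'I_n.+2) (s : simplex A n.+1) :
  is_simplex A n (take i (val s) ++ drop i.+1 (val s)).
Proof.
case: s => s /= /and3P[/eqP sz srt sA].
have sub : subseq (take i s ++ drop i.+1 s) s.
  rewrite -[X in subseq _ X](cat_take_drop i) cat_subseq //.
  by rewrite -add1n -drop_drop drop_subseq.
apply/and3P; split.
- by rewrite size_cat size_take size_drop sz ltn_ord subSS subnKC // -ltnS.
- exact: subseq_sorted lt_trans _ _ sub srt.
- by apply/allP => x /(mem_subseq sub); apply/allP.
Qed.

Definition face A n (i : 'I_n.+2) (s : simplex A n.+1) : simplex A n :=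
  exist (is_simplex A n) _ (face_subproof i s).

Definition boundary A n : {freeg simplex A n.+1} -> {freeg simplex A n} :=
  fglift (fun s => (\sum_(i < n.+2) << (-1) ^+ i *g face i s >>)%R).

HB.instance Definition _ A n :=
  GRing.isZmodMorphism.Build _ _ (@boundary A n) (lift_is_additive _).

Definition is_cycle A n : {pred {freeg simplex A n}} :=
  match n return {pred {freeg simplex A n}} with
  | 0 => predT
  | _.+1 => fun c => boundary c == 0%R
  end.

Lemma is_cycle_zmod_closed A n : zmod_closed (@is_cycle A n).
Proof.
case: n => [|n]; first by split.
split=> [|c c' /eqP c0 /eqP c'0]; apply/eqP.
  by rewrite raddf0.
by rewrite raddfB /= c0 c'0 subr0.
Qed.
HB.instance Definition _ A n :=
  GRing.isZmodClosed.Build _ (@is_cycle A n) (@is_cycle_zmod_closed A n).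

Definition cycles A n : Type := {c | @is_cycle A n c}.
HB.instance Definition _ A n := SubChoice.on (cycles A n).
HB.instance Definition _ A n := [SubChoice_isSubZmodule of cycles A n by <:].

Definition is_boundary A n : {pred cycles A n} :=
  fun z => `[< exists c, boundary c = val z >].

Lemma is_boundary_zmod_closed A n : zmod_closed (@is_boundary A n).
Proof.
split; first by apply/asboolP; exists 0%R; rewrite !raddf0.
move=> z z' /asboolP[c cz] /asboolP[c' cz']; apply/asboolP; exists (c - c')%R.
by rewrite !raddfB /= cz cz'.
Qed.
HB.instance Definition _ A n :=
  GRing.isZmodClosed.Build _ (@is_boundary A n) (@is_boundary_zmod_closed A n).

Definition homology A n : zmodType := Quotient.quot (@is_boundary A n).

(* A simplicial complex is connected when its 1-skeleton is. *)
Definition connected_complex A : Prop :=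
  forall x y, A x -> A y ->
    exists2 s : seq P, {subset s <= A} & path >=<%O x s /\ last x s = y.

Definition down x : set P := [set y | y <= x].
Definition sdown x : set P := [set y | y < x].

Definition maximal_chain (D C : set P) : Prop :=
  [/\ C `<=` D, total_on C <=%O &
      forall C', C' `<=` D -> total_on C' <=%O -> C `<=` C' -> C' = C].

Definition has_degree x n : Prop :=
  forall C, maximal_chain (down x) C -> (C #= `I_n.+1)%card.

(* Meaningful only when [P] is graded; [n] is then unique, since [down x]
   contains a maximal chain. *)
Definition degree x : nat := xget 0%N [set n | has_degree x n].

Definition maximal_of A y : Prop := A y /\ forall z, A z -> y <= z -> z = y.

Definition hasse x y : Prop := y < x /\ ~ exists z, y < z < x.

Section Matching.
Variable M : set (P * P).

Definition matching : Prop :=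
  (forall x y, M (x, y) -> hasse x y) /\
  (forall e e' v, M e -> M e' ->
     (v = e.1 \/ v = e.2) -> (v = e'.1 \/ v = e'.2) -> e = e').

Definition marrow : rel P :=
  fun x y => `[< (hasse x y /\ ~ M (x, y)) \/ M (y, x) >].

Definition morse_matching : Prop :=
  matching /\ forall c : seq P, cycle marrow c -> c = [::].

Definition critical x : Prop := forall e, M e -> x <> e.1 /\ x <> e.2.

Definition ray (r : nat -> P) : Prop :=
  injective r /\ forall i, marrow (r i) (r i.+1).

Definition ray_equiv (r s : nat -> P) : Prop :=
  exists K N, forall i, r (K + i)%N = s (N + i)%N.

Definition ray_class (r : nat -> P) : set (nat -> P) :=
  [set s | ray s /\ ray_equiv r s].

Definition ray_classes : set (set (nat -> P)) := [set ray_class r | r in ray].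

Definition ray_degree (r : nat -> P) n : Prop :=
  (exists j, degree (r j) = n) /\ forall j, (n <= degree (r j))%N.

Definition num_critical n : \bar int :=
  ecard [set x | critical x /\ degree x = n].

Definition num_rays n : \bar int :=
  ecard [set ray_class r | r in [set r | ray r /\ ray_degree r n]].

End Matching.
End OrderComplex.

Definition graded {d} (P : porderType d) : Prop :=
  forall x : P, exists n, has_degree x n.

Definition finite_principal_ideals {d} (P : porderType d) : Prop :=
  forall x : P, finite_set (down x).

Definition homologically_admissible {d} (P : porderType d) : Prop :=
  [/\ graded P, finite_principal_ideals P &
      forall x y : P, maximal_of (sdown x) y ->
        let A := sdown x `\ y in
        [/\ A !=set0, connected_complex A &
            forall n (h : homology A n.+1), h = 0%R]].

Definition betti {d} (P : porderType d) n : \bar int :=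
  rank (homology [set: P] n).

(* Main.v *)
(** By a diagonal argument, a ray with infinitely many detours (arrow paths leaving
    it and coming back) would yield infinitely many classes of rays.  So every
    class contains a ray without detours all of whose vertices lead to the same
    classes.  Reversing [M] along one such ray per class gives a matching without
    rays, whose critical elements are those of [M] together with the origin of each
    reversed ray, an element of the same degree as the ray.

    For a matching without rays reachability is well founded, so every finite set
    lies in a finite down-set closed under matched partners, and two nested such
    sets are joined by adding one pair or one critical element at a time.  Adding a
    matched pair [(x, y)] does not change homology, since the link of [x] without
    [y] is acyclic.  Adding a critical [x] of degree [n] either raises the rank of
    [H_n] or lowers that of [H_(n-1)] by one, since [sdown x] has the homology of an
    [(n-1)]-sphere.  If [e n] counts the steps of the second kind, then
    [#critical_n = beta n + e n + e n.+1]; the (in)equalities follow, since the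
    homology of [P] is the direct limit of that of its finite closed subsets. *)

From HB Require Import structures.
Require Import Defs.
From mathcomp Require Import finmap generic_quotient ring_quotient freeg.
From mathcomp Require Import all_boot all_order all_algebra.
From mathcomp Require Import ring zify.
From mathcomp Require Import boolp classical_sets functions cardinality fsbigop.
From mathcomp Require Import constructive_ereal ereal.

Set Implicit Arguments.
Unset Strict Implicit.
Unset Printing Implicit Defensive.

Import Order.TTheory GRing.Theory Num.Theory.
Local Open Scope classical_set_scope.
Local Open Scope ring_scope.

(** * Ranks of subquotients of abelian groups *)

Section Rank.
Context {V : zmodType}.
Implicit Types (S T : set V).

(** A closed set contains everything reachable from its elements, so no vertex of a ray lies in a
    finite closed set. This is why rays have to disappear before [P] can be exhausted by finite
    pieces. Detours have to be excluded beforehand: once a ray is reversed, a path that leaves it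
    and comes back to it further on closes up to a directed cycle.

    All homology groups are subquotients of the single group [{freeg seq P}], so that an inclusion
    of subposets is a literal inclusion of chains and each use of an exact sequence becomes an
    explicit correction of a chain by a boundary. The fundamental cycle of [sdown x] is only known
    to have nonzero coefficients, and integers cannot be divided; every such division is replaced by
    multiplication by a nonzero integer, which torsion-free ranks do not notice. *)

Definition subgroup S := S 0 /\ forall u v, S u -> S v -> S (u - v).

Lemma subgroupN S u : subgroup S -> S u -> S (- u).
Proof. by case=> S0 SB Su; rewrite -sub0r; apply: SB. Qed.

Lemma subgroupD S u v : subgroup S -> S u -> S v -> S (u + v).
Proof.
by move=> sS Su Sv; rewrite -[v]opprK; apply: sS.2 => //; apply: subgroupN.
Qed.

Lemma subgroupMz S u (m : int) : subgroup S -> S u -> S (u *~ m).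
Proof.
move=> sS Su; have pos n : S (u *+ n).
  by elim: n => [|n IHn]; [case: sS | rewrite mulrS; apply: subgroupD].
by case: m => n; rewrite ?NegzE ?mulrNz -pmulrn //; apply: subgroupN.
Qed.

Lemma subgroup_sum S (I : Type) (s : seq I) (Q : pred I) (F : I -> V) :
  subgroup S -> (forall i, Q i -> S (F i)) -> S (\sum_(i <- s | Q i) F i).
Proof.
move=> sS SF; apply: (big_ind S) => //; first by case: sS.
by move=> u v Su Sv; apply: subgroupD.
Qed.

Lemma subgroupI S T : subgroup S -> subgroup T -> subgroup (S `&` T).
Proof.
move=> [S0 SB] [T0 TB]; split=> // u v [Su Tu] [Sv Tv].
by split; [apply: SB | apply: TB].
Qed.

(* Independence of a family of [S] modulo [T]; with [T] a subgroup of [S],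
   [has_rank S T r] says that [S / T] has torsion-free rank [r]. *)
Definition indep S T k (v : 'I_k -> V) :=
  (forall i, S (v i)) /\
  forall c : 'I_k -> int, T (\sum_i v i *~ c i) -> forall i, c i = 0.

Definition has_rank S T r :=
  (exists v : 'I_r -> V, indep S T v) /\
  forall v : 'I_r.+1 -> V, ~ indep S T v.

Lemma indep_drop S T k (v : 'I_k.+1 -> V) j :
  indep S T v -> indep S T (fun i => v (lift j i)).
Proof.
move=> [Sv Tv]; split=> // c Tc i.
pose c' i := if unlift j i is Some i' then c i' else 0.
have -> : c i = c' (lift j i) by rewrite /c' liftK.
apply: Tv; rewrite (bigD1_ord j) //= {1}/c' unlift_none mulr0z add0r.
by under eq_bigr => l _ do rewrite /c' liftK.
Qed.

Lemma indep_le S T j n (v : 'I_(n + j) -> V) :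
  indep S T v -> exists w : 'I_j -> V, indep S T w.
Proof.
elim: n v => [|n IHn] v Sv; first by exists v.
exact: IHn (indep_drop ord0 Sv).
Qed.

Lemma has_rank_ge S T r k (v : 'I_k -> V) :
  has_rank S T r -> indep S T v -> (k <= r)%N.
Proof.
move=> [_ maxr] Sv; rewrite leqNgt; apply/negP => lt_rk.
by move: v Sv; rewrite -(subnK lt_rk) => v /indep_le[w /maxr].
Qed.



Lemma indep_mono S T S' T' k (v : 'I_k -> V) :
  subgroup S -> S `<=` S' ->
  (forall u, S u -> T' u -> exists2 m : int, m != 0 & T (u *~ m)) ->
  indep S T v -> indep S' T' v.
Proof.
move=> sS SS' S_T' [Sv Tv]; split=> [i|c T'c i]; first exact: SS'.
have Sc : S (\sum_i v i *~ c i).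
  by apply: subgroup_sum => // l _; apply: subgroupMz.
have [m m0 Tm] := S_T' _ Sc T'c.
have /Tv/(_ i)/eqP : T (\sum_i v i *~ (c i * m)).
  by rewrite mulrz_suml in Tm; under eq_bigr => l _ do rewrite mulrzA.
by rewrite mulf_eq0 (negbTE m0) orbF => /eqP.
Qed.

(** The map [S / T -> S' / T'] induced by inclusion has torsion kernel and torsion cokernel, so it
    becomes an isomorphism over the rationals. *)
Lemma has_rank_commensurable S T S' T' r :
  subgroup S -> subgroup S' -> subgroup T' -> S `<=` S' -> T `<=` T' ->
  (forall u, S' u -> exists2 m : int, m != 0 & exists2 s, S s & T' (u *~ m - s)) ->
  (forall u, S u -> T' u -> exists2 m : int, m != 0 & T (u *~ m)) ->
  has_rank S T r -> has_rank S' T' r.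
Proof.
move=> sS sS' sT' SS' TT' S'S S_T' [[v Sv] maxr]; split.
  by exists v; apply: indep_mono Sv.
move=> w [S'w T'w]; have /choice[m mP] i : exists ms : int * V,
    [/\ ms.1 != 0, S ms.2 & T' (w i *~ ms.1 - ms.2)].
  by have [m m0 [s Ss Ts]] := S'S _ (S'w i); exists (m, s).
apply: (maxr (fun i => (m i).2)); split=> [i|c Tc i]; first by case: (mP i).
have /T'w/(_ i)/eqP : T' (\sum_i w i *~ ((m i).1 * c i)).
  have -> : \sum_i w i *~ ((m i).1 * c i) =
      \sum_i (w i *~ (m i).1 - (m i).2) *~ c i + \sum_i (m i).2 *~ c i.
    rewrite -big_split /=; apply: eq_bigr => l _.
    by rewrite mulrzBl mulrzA subrK.
  apply: subgroupD => //; last exact: TT'.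
  by apply: subgroup_sum => // l _; apply: subgroupMz => //; case: (mP l).
by have [/negbTE m0 _ _] := mP i; rewrite mulf_eq0 m0 => /eqP.
Qed.

(** Rank-nullity for the map to the integers that [f] induces on [S / T]; its image is nonzero and
    contributes exactly one. *)
Lemma has_rank_succ S T r (f : {additive V -> int}) z :
  subgroup S -> S z -> f z != 0 -> (forall u, T u -> f u = 0) ->
  has_rank (S `&` [set u | f u = 0]) T r -> has_rank S T r.+1.
Proof.
move=> sS Sz fz fT [[v [Sv Tv]] maxr]; split.
  exists (fun i => if unlift ord0 i is Some j then v j else z).
  split=> [i|c]; first by case: unliftP => [j|] _ //; case: (Sv j).
  rewrite big_ord_recl unlift_none.
  under eq_bigr => j _ do rewrite liftK.
  move=> Tc; have /eqP := fT _ Tc.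
  rewrite raddfD raddf_sum big1 => [|j _]; last first.
    by rewrite raddfMz; have [_ /= ->] := Sv j; rewrite mul0rz.
  rewrite addr0 raddfMz /= mulrzz mulf_eq0 (negbTE fz) => /eqP c0.
  rewrite c0 mulr0z add0r in Tc.
  by move=> i; case: (unliftP ord0 i) => [j|] -> //; apply: (Tv (fun j => c _) Tc).
move=> v' [Sv' Tv'].
have [[j fj]|fv'] := pselect (exists j, f (v' j) != 0); last first.
  have [_ indep0] := indep_drop ord0 (conj Sv' Tv').
  apply: (maxr (fun i => v' (lift ord0 i))); split=> // i; split=> //=.
  by apply: contrapT => /eqP fi; apply: fv'; exists (lift ord0 i).
(* Elimination with pivot [v' j]: these combinations lie in the kernel of [f]. *)
pose w i := v' (lift j i) *~ f (v' j) - v' j *~ f (v' (lift j i)).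
apply: (maxr w); split=> [i|c Tc i].
  split; first by apply: sS.2; apply: subgroupMz.
  by rewrite /= /w raddfB !raddfMz /= !mulrzz mulNr mulrC subrr.
pose c' i := if unlift j i is Some i' then f (v' j) * c i' else
  - \sum_i' f (v' (lift j i')) * c i'.
have : c' (lift j i) = 0.
  apply: Tv'; rewrite (bigD1_ord j) //= {1}/c' unlift_none.
  under eq_bigr => l _ do rewrite /c' liftK.
  have wE l : w l *~ c l =
      v' (lift j l) *~ (f (v' j) * c l) - v' j *~ (f (v' (lift j l)) * c l).
    by rewrite /w mulrzBl -!mulrzA.
  move: Tc; rewrite (eq_bigr _ (fun l _ => wE l)).
  by rewrite sumrB addrC mulrNz mulrz_sumr.
by rewrite /c' liftK => /eqP; rewrite mulf_eq0 (negbTE fj) => /eqP.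
Qed.

(** Modulo [T], the elements of [S] that die in [T'] are rational multiples of [t], which has
    infinite order; killing them costs one dimension. The proof is a Steinitz exchange of [t] for a
    member of the independent family. *)
Lemma has_rank_pred S T T' r t :
  subgroup S -> subgroup T -> subgroup T' -> T `<=` T' -> S t -> T' t ->
  (forall m : int, T (t *~ m) -> m = 0) ->
  (forall u, S u -> T' u ->
     exists2 p : int, p != 0 & exists q : int, T (u *~ p - t *~ q)) ->
  has_rank S T r -> exists2 r', r = r'.+1 & has_rank S T' r'.
Proof.
move=> sS sT sT' TT' St T't tfree T'T [[v [Sv Tv]] maxr].
have add_t k (w : 'I_k -> V) c0 (c : 'I_k -> int) : forall c' : 'I_k.+1 -> int,
    c0 = c' ord0 -> (forall i, c i = c' (lift ord0 i)) ->
    \sum_i (if unlift ord0 i is Some j then w j else t) *~ c' i =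
    t *~ c0 + \sum_i w i *~ c i.
  move=> c' -> cc'; rewrite big_ord_recl unlift_none; congr (_ + _).
  by apply: eq_bigr => i _; rewrite liftK cc'.
(* By maximality [t] and [v] are dependent modulo [T]. Since [t] alone is free, some [v j] occurs in
   the relation; that one will be dropped. *)
have [c [Tc nzc]] : exists c : 'I_r.+1 -> int,
    T (t *~ c ord0 + \sum_i v i *~ c (lift ord0 i)) /\ exists i, c i != 0.
  apply: contrapT => noc.
  apply: (maxr (fun i => if unlift ord0 i is Some j then v j else t)).
  split=> [i|c Tc i]; first by case: unliftP.
  apply: contrapT => /eqP ci; apply: noc; exists c; split; last by exists i.
  by rewrite -(add_t _ _ _ _ c).
have [j cj] : exists j, c (lift ord0 j) != 0.
  apply: contrapT => noj.
  have cl j : c (lift ord0 j) = 0.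
    by apply: contrapT => /eqP cj; apply: noj; exists j.
  move: Tc; rewrite big1 ?addr0 => [/tfree c0|j _]; last by rewrite cl mulr0z.
  case: nzc => i; case: (unliftP ord0 i) => [j|] ->; last by rewrite c0 eqxx.
  by rewrite cl eqxx.
case: r => [|r] in v Sv Tv maxr add_t c Tc nzc j cj *; first by case: j cj.
exists r => //; split.
  exists (fun i => v (lift j i)); split=> // d T'd i.
  have Sd : S (\sum_i v (lift j i) *~ d i).
    by apply: subgroup_sum => // l _; apply: subgroupMz.
  have [p p0 [q Tpq]] := T'T _ Sd T'd.
  (* The coefficients of [q] times [Tc] plus [c ord0] times [Tpq], in which [t] cancels. At the
     dropped index only [c (lift ord0 j) * q] is left, which forces [q = 0]. *)
  pose e i := c (lift ord0 i) * q +
    (if unlift j i is Some l then c ord0 * (p * d l) else 0).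
  have Te : T (\sum_i v i *~ e i).
    have -> : \sum_i v i *~ e i = (\sum_i v i *~ c (lift ord0 i)) *~ q +
        (\sum_i v (lift j i) *~ d i) *~ p *~ c ord0.
      transitivity (\sum_i (v i *~ c (lift ord0 i) *~ q +
          if unlift j i is Some l then v i *~ d l *~ p *~ c ord0 else 0)).
        apply: eq_bigr => l _; rewrite /e mulrzDr mulrzA; congr (_ + _).
        by case: (unlift j l) => [l'|]; rewrite ?mulr0z // mulrC mulrzA [in LHS]mulrC mulrzA.
      rewrite big_split /= !mulrz_suml; congr (_ + _).
      rewrite [LHS](bigD1_ord j) //= unlift_none add0r.
      by apply: eq_bigr => l _; rewrite liftK.
    set X := \sum_i _; set Y := \sum_i _; rewrite -/X -/Y in Tc Tpq.
    have -> : X *~ q + Y *~ p *~ c ord0 =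
        (t *~ c ord0 + X) *~ q + (Y *~ p - t *~ q) *~ c ord0.
      rewrite mulrzDl mulrzBl -[t *~ c _ *~ q]mulrzA -[t *~ q *~ _]mulrzA.
      by rewrite [q * _]mulrC [X in _ = X]addrC addrA subrK addrC.
    by apply: subgroupD => //; apply: subgroupMz.
  have qj : e j = 0 by apply: Tv.
  have q0 : q = 0.
    by move: qj; rewrite /e unlift_none addr0 => /eqP; rewrite mulf_eq0 (negbTE cj) => /eqP.
  have T_d : T (\sum_i v i *~
      (if unlift j i is Some l then d l * p else 0)).
    rewrite (bigD1_ord j) //= unlift_none mulr0z add0r.
    under eq_bigr => l _ do rewrite liftK mulrzA.
    by rewrite -mulrz_suml; move: Tpq; rewrite q0 mulr0z subr0.
  have := Tv _ T_d (lift j i); rewrite liftK => /eqP.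
  by rewrite mulf_eq0 (negbTE p0) orbF => /eqP.
move=> w [Sw T'w].
apply: (maxr (fun i => if unlift ord0 i is Some j then w j else t)).
split=> [i|d]; first by case: unliftP.
rewrite (add_t _ _ (d ord0) (fun i => d (lift ord0 i))) // => Td.
have d0 l : d (lift ord0 l) = 0.
  apply: (T'w (fun i => d (lift ord0 i))).
  rewrite -[X in T' X](addKr (t *~ d ord0)).
  apply: subgroupD => //; last exact: TT'.
  by apply: subgroupN => //; apply: subgroupMz.
move: Td; rewrite big1 ?addr0 => [/tfree dt i|l _]; last by rewrite d0 mulr0z.
by case: (unliftP ord0 i) => [l|] ->.
Qed.
End Rank.

(** * The augmented order complex *)

Section Support.
Context {K : choiceType}.
Implicit Types (X : set K) (u : {freeg K}).

Definition supported X : set {freeg K} := [set u | forall s, coeff s u != 0 -> X s].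

Lemma supported_subgroup X : subgroup (supported X).
Proof.
split=> [s|u v Xu Xv s]; first by rewrite coeff0 eqxx.
have [u0|/eqP] := eqVneq (coeff s u) 0; last by move=> /eqP /Xu.
have [v0|/eqP] := eqVneq (coeff s v) 0; last by move=> /eqP /Xv.
by rewrite coeffB u0 v0 subrr eqxx.
Qed.

Lemma supported1 X s : X s -> supported X << s >>.
Proof.
by move=> Xs t; rewrite coeffU mul1r; have [<-|] := eqVneq s t; rewrite // eqxx.
Qed.

Lemma supported_ind X (Q : set {freeg K}) :
  subgroup Q -> (forall s, X s -> Q << s >>) -> supported X `<=` Q.
Proof.
move=> sQ QX u Xu; rewrite -[u]freeg_sumE big_seq_cond.
apply: subgroup_sum => // s; rewrite andbT mem_dom => /Xu/QX Qs.
have -> : << coeff s u *g s >> = << s >> *~ coeff s u :> {freeg K}.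
  by rewrite freegU_mulz intz.
exact: subgroupMz.
Qed.

Lemma supported_sub X Y : X `<=` Y -> supported X `<=` supported Y.
Proof. by move=> XY u Xu s /Xu/XY. Qed.

Lemma coeff_unsupported X u s : supported X u -> ~ X s -> coeff s u = 0.
Proof. by move=> Xu Xs; apply: contrapT => /eqP/Xu. Qed.

Lemma freegP u v : (forall s, coeff s u = coeff s v) -> u = v.
Proof. by move=> uv; apply/eqP/freeg_eqP. Qed.

Lemma lift1 (M : lmodType int) (f : K -> M) s : fglift f << s >> = f s.
Proof. by rewrite liftU scale1r. Qed.

Lemma supported_image (f : {freeg K} -> {freeg K}) X Y :
  additive f -> (forall s, X s -> supported Y (f << s >>)) ->
  forall u, supported X u -> supported Y (f u).
Proof.
move=> fB XY; apply: (@supported_ind X (f @^-1` supported Y)) => //.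
split=> [|u v Yu Yv]; last first.
  by rewrite /= fB; apply: (supported_subgroup Y).2.
by rewrite /= -(subrr 0) fB subrr; case: (supported_subgroup Y).
Qed.

Lemma additive_ext (V : zmodType) (f g : {freeg K} -> V) :
  additive f -> additive g -> (forall s, f << s >> = g << s >>) -> f =1 g.
Proof.
move=> fB gB fg u; apply: (@supported_ind setT [set u | f u = g u]) => [|s _|s _] //.
split=> [|v w /= fv fw]; last by rewrite /= fB gB fv fw.
by rewrite /= -[in LHS](subrr 0) -[in RHS](subrr 0) fB gB !subrr.
Qed.

End Support.

Ltac freeg_ring := apply: freegP => ?; rewrite ?(coeffD, coeffB, coeffN, coeff0); ring.

Section Chains.
Context {d : Order.disp_t} {P : porderType d}.
Implicit Types (A B L : set P) (x y z : P) (s t : seq P) (u v w : {freeg seq P}).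

Definition cone x : {freeg seq P} -> {freeg seq P} :=
  fglift (fun s => << x :: s >>).
HB.instance Definition _ x :=
  GRing.isZmodMorphism.Build _ _ (cone x) (lift_is_additive _).

(* Chains are listed in decreasing order, so that the top element comes first, and
   [::] is a chain: this is the augmented complex, up to a sign in each degree. *)
Fixpoint del s : {freeg seq P} :=
  if s is x :: t then << t >> - cone x (del t) else 0.

Definition bd : {freeg seq P} -> {freeg seq P} := fglift del.
HB.instance Definition _ :=
  GRing.isZmodMorphism.Build _ _ bd (lift_is_additive _).

(** Left inverse of [cone x]; zero on sequences that do not start with [x]. *)
Definition strip x : {freeg seq P} -> {freeg seq P} :=
  fglift (fun s => if s is y :: t then if y == x then << t >> else 0 else 0).
HB.instance Definition _ x :=
  GRing.isZmodMorphism.Build _ _ (strip x) (lift_is_additive _).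

Definition proj k : {freeg seq P} -> {freeg seq P} :=
  fglift (fun s => if size s == k then << s >> else 0).
HB.instance Definition _ k :=
  GRing.isZmodMorphism.Build _ _ (proj k) (lift_is_additive _).

Lemma coneU x s : cone x << s >> = << x :: s >>. Proof. exact: lift1. Qed.
Lemma bdU s : bd << s >> = del s. Proof. exact: lift1. Qed.

Lemma stripU x s : strip x << s >> =
  if s is y :: t then if y == x then << t >> else 0 else 0.
Proof. exact: lift1. Qed.
Lemma projU k s : proj k << s >> = if size s == k then << s >> else 0.
Proof. exact: lift1. Qed.

(** Coning is a contracting homotopy; the empty chain makes the formula hold for single points as
    well. *)
Lemma bd_cone x u : bd (cone x u) = u - cone x (bd u).
Proof.
move: u; apply: additive_ext => [u v|u v|s]; first by rewrite !raddfB.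
  by rewrite !raddfB /=; freeg_ring.
by rewrite coneU !bdU.
Qed.

Lemma bdK u : bd (bd u) = 0.
Proof.
move: u; apply: additive_ext => [u v|u v|s]; first by rewrite !raddfB.
  by rewrite subrr.
rewrite bdU; elim: s => [|x s IHs] /=; first by rewrite raddf0.
by rewrite raddfB /= bdU bd_cone IHs raddf0 subr0 subrr.
Qed.

Lemma coeff_cone s x u : coeff s (cone x u) =
  if s is y :: t then if y == x then coeff t u else 0 else 0.
Proof.
move: u; apply: additive_ext => [u v|u v|t]; first by rewrite !raddfB.
  by case: s => [|y s]; rewrite ?subrr //; case: eqP => _; rewrite ?subrr ?raddfB.
rewrite coneU coeffU mul1r; case: s => [|y s] //; rewrite coeffU mul1r.
by rewrite eqseq_cons eq_sym; case: eqP.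
Qed.

Lemma coeff_strip s x u : coeff s (strip x u) = coeff (x :: s) u.
Proof.
move: u; apply: additive_ext => [u v|u v|t]; try by rewrite !raddfB.
rewrite stripU coeffU mul1r; case: t => [|y t]; first by rewrite coeff0.
by rewrite eqseq_cons; case: eqP; rewrite ?coeffU ?coeff0 ?mul1r.
Qed.

Lemma coeff_proj s k u : coeff s (proj k u) = if size s == k then coeff s u else 0.
Proof.
move: u; apply: additive_ext => [u v|u v|t]; first by rewrite !raddfB.
  by case: ifP; rewrite ?subrr ?raddfB.
rewrite projU; have [ts|ts] := eqVneq t s.
  by rewrite ts; case: ifP => _; rewrite ?coeff0.
by rewrite coeffU (negbTE ts) mulr0 if_same; case: ifP; rewrite ?coeff0 // coeffU (negbTE ts) mulr0.
Qed.

Lemma del_supported s : supported [set t | subseq t s /\ size s = (size t).+1] (del s).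
Proof.
elim: s => [|x s IHs] /= t; first by rewrite coeff0 eqxx.
rewrite coeffB coeff_cone coeffU mul1r; have [<- _|st] := eqVneq s t.
  by split=> //; apply: subseq_cons.
rewrite sub0r oppr_eq0; case: t st => [|y t] st; first by rewrite eqxx.
have [->|_] := eqVneq y x; last by rewrite eqxx.
move=> /IHs[ts sz]; split=> /=; last by rewrite sz.
  by rewrite eqxx.
Qed.

Lemma proj_bd k u : bd (proj k.+1 u) = proj k (bd u).
Proof.
move: u; apply: additive_ext => [u v|u v|s]; try by rewrite !raddfB.
rewrite projU bdU; apply: freegP => t; rewrite coeff_proj.
have [ts|] := eqVneq (coeff t (del s)) 0.
  by case: ifP; rewrite ?bdU ?raddf0 ts if_same.
by move=> /del_supported[_ ->]; rewrite eqSS; case: ifP; rewrite ?bdU ?raddf0.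
Qed.

Definition chain A : set (seq P) := [set s | sorted >%O s /\ forall x, x \in s -> A x].
Definition chains A := supported (chain A).
Definition chainsn k A := supported [set s | chain A s /\ size s = k].

Lemma chainS A B s : A `<=` B -> chain A s -> chain B s.
Proof. by move=> AB [ss sA]; split=> // x /sA/AB. Qed.

Lemma chains_sub A B : A `<=` B -> chains A `<=` chains B.
Proof. by move=> AB; apply: supported_sub => s; apply: chainS. Qed.

Lemma chainsnS k A B : A `<=` B -> chainsn k A `<=` chainsn k B.
Proof. by move=> AB; apply: supported_sub => s [As sk]; split=> //; apply: chainS As. Qed.

Lemma chainsn_chains k A : chainsn k A `<=` chains A.
Proof. by apply: supported_sub => s []. Qed.

Lemma chainsn_size k A : chainsn k A `<=` supported [set s | size s = k].
Proof. by apply: supported_sub => s []. Qed.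

Lemma chain_cons A x s : chain A (x :: s) <-> A x /\ chain (A `&` [set y | (y < x)%O]) s.
Proof.
split=> [[ss sA]|[Ax [ss sA]]].
  split; first by apply: sA; rewrite inE eqxx.
  move: ss; rewrite /= (path_sortedE (rev_trans lt_trans)) => /andP[/allP lt_x ss].
  by split=> // y ys; split; [apply: sA; rewrite inE ys orbT | apply: lt_x].
split=> [|y]; last by rewrite inE => /predU1P[->|/sA[]].
rewrite /= (path_sortedE (rev_trans lt_trans)) ss andbT.
by apply/allP => y /sA[].
Qed.

Lemma chain_subseq A s t : subseq t s -> chain A s -> chain A t.
Proof.
move=> ts [ss sA]; split=> [|x /(mem_subseq ts)/sA //].
exact: subseq_sorted (rev_trans lt_trans) _ _ ts ss.
Qed.

Lemma chains_bd A u : chains A u -> chains A (bd u).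
Proof.
apply: supported_image => [|s As]; first exact: raddfB.
by rewrite bdU => t /del_supported[ts _]; apply: chain_subseq ts As.
Qed.

Lemma bd_supported X u : supported X u ->
  supported [set s | exists t, [/\ X t, subseq s t & size t = (size s).+1]] (bd u).
Proof.
move: u; apply: supported_image => [|t Xt s]; first exact: raddfB.
by rewrite bdU => /del_supported[st sz]; exists t.
Qed.

Lemma chainsn_bd k A u : chainsn k.+1 A u -> chainsn k A (bd u).
Proof.
apply: supported_image => [|s [As sk]]; first exact: raddfB.
rewrite bdU => t /del_supported[ts]; rewrite sk => -[->].
by split=> //; apply: chain_subseq ts As.
Qed.

Lemma chainsn0_bd A u : chainsn 0 A u -> bd u = 0.
Proof.
apply: (@supported_ind _ _ [set u | bd u = 0]) => [|s [_ /size0nil ->]].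
  split=> [|v w /= v0 w0]; first exact: raddf0.
  by rewrite /= raddfB /= v0 w0 subrr.
by rewrite /= bdU.
Qed.

Lemma proj_chains k A u : chains A u -> chainsn k A (proj k u).
Proof. move=> Au s; rewrite coeff_proj; have [sk /Au|] := eqVneq (size s) k.
  by split.
by rewrite eqxx. Qed.

Lemma proj_id k A u : chainsn k A u -> proj k u = u.
Proof.
move=> /chainsn_size Au; apply: freegP => s; rewrite coeff_proj.
by have [//|/eqP sk] := eqVneq (size s) k; rewrite (coeff_unsupported Au).
Qed.

(** No element of [A] lies above [x], so [x] can only be the top of a chain: [a] collects the chains
    without [x], and [f] what remains under [x] in the others. *)
Lemma cone_decomposition A x u :
  (forall a, A a -> ~~ (x < a)%O) -> chains (A `|` [set x]) u ->
  exists a f, [/\ chains A a, chains (A `&` [set y | (y < x)%O]) f & u = a + cone x f].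
Proof.
move=> xA Au; exists (u - cone x (strip x u)), (strip x u).
have chain_link s : chain (A `|` [set x]) (x :: s) -> chain (A `&` [set y | (y < x)%O]) s.
  by move=> /chain_cons[_]; apply: chainS => y [[//|->]] /=; rewrite ltxx.
split; last by rewrite subrK.
- move=> [|y s]; rewrite coeffB coeff_cone ?subr0; first by move=> _; split.
  have [->|/eqP yx] := eqVneq y x; first by rewrite coeff_strip subrr eqxx.
  rewrite subr0 => /Au Ays.
  have Ay : A y by have [[|/yx]] := (chain_cons _ _ _).1 Ays.
  have [ss ?] := Ays; split=> // z zys; have [] := Ays.2 z zys => // zx.
  move: zys; rewrite inE => /predU1P[-> //|zs].
  have [_ [_ /(_ z zs)[_ /=]]] := (chain_cons _ _ _).1 Ays.
  by rewrite zx (negbTE (xA _ Ay)).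
- by move=> s; rewrite coeff_strip => /Au/chain_link.
Qed.

Lemma chains_cone A x u :
  chains (A `&` [set y | (y < x)%O]) u -> A x -> chains A (cone x u).
Proof.
move=> Au Ax; move: u Au; apply: supported_image => [|s As]; first exact: raddfB.
by rewrite coneU; apply: supported1; apply/chain_cons.
Qed.

Lemma chains_cone_eq0 A x u : ~ A x -> chains A (cone x u) -> u = 0.
Proof.
move=> Ax Au; apply: freegP => s; rewrite coeff0; apply: contrapT => /eqP us.
have /Au/chain_cons[] // : coeff (x :: s) (cone x u) != 0.
by rewrite coeff_cone eqxx.
Qed.

(** All degrees at once and in the reduced sense: the empty chain is a cycle, so an acyclic [L] is
    nonempty. *)
Definition acyclic L :=
  forall u, chains L u -> bd u = 0 -> exists2 v, chains L v & bd v = u.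

Lemma chains_subgroup A : subgroup (chains A). Proof. exact: supported_subgroup. Qed.

Definition dclosed A := forall a b, A a -> (b <= a)%O -> A b.

Lemma hasse_not_lt x y a : hasse x y -> (sdown x `\ y) a -> ~~ (y < a)%O.
Proof.
move=> [_ yx] [/= ax _]; apply/negP => ya; apply: yx; exists a; exact/andP.
Qed.

Lemma sdownU x y : hasse x y -> sdown x = (sdown x `\ y) `|` [set y].
Proof.
move=> [yx _]; rewrite predeqE => a; split=> [ax|[[]//|-> //]].
by have [->|/eqP] := eqVneq a y; [right | left].
Qed.

Lemma link_sdown A x : dclosed (A `|` [set x]) -> A `&` [set y | (y < x)%O] = sdown x.
Proof.
move=> cA; rewrite predeqE => y; split=> [[]//|/= yx]; split=> //.
have [//|/= yx'] := cA x y (or_intror erefl) (ltW yx).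
by move: yx; rewrite yx' /sdown /= ltxx.
Qed.

Lemma link_sdown2 x y : hasse x y ->
  (sdown x `\ y) `&` [set z | (z < y)%O] = sdown y.
Proof.
move=> [yx _]; rewrite predeqE => z; split=> [[]//|/= zy]; split=> //.
split; first exact: lt_trans zy yx.
by move: zy => /[swap] ->; rewrite /sdown /= ltxx.
Qed.

Lemma sdown_decomposition x y u : hasse x y -> chains (sdown x) u ->
  exists l h, [/\ chains (sdown x `\ y) l, chains (sdown y) h & u = l + cone y h].
Proof.
move=> xy xu; rewrite -(link_sdown2 xy); apply: cone_decomposition => [z|].
  exact: hasse_not_lt.
by rewrite -sdownU.
Qed.

Lemma dclosed_not_lt A x :
  dclosed A -> ~ A x -> forall a, A a -> ~~ (x < a)%O.
Proof. by move=> cA Ax a Aa; apply/negP => /ltW /(cA _ _ Aa). Qed.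

(** Write [u] as [a + cone y b + cone x (l + cone y h)]. Neither [x] nor [y] occurs in [bd u], so
    [l + cone y h] is a cycle and [h = bd b]. Hence [l + b] is a cycle of [sdown x] without [y], and
    bounds there by acyclicity. *)
Lemma pair_relative A x y u : hasse x y -> acyclic (sdown x `\ y) ->
  dclosed A -> ~ A x -> ~ A y -> dclosed (A `|` [set y] `|` [set x]) ->
  dclosed (A `|` [set y]) ->
  chains (A `|` [set y] `|` [set x]) u -> chains A (bd u) ->
  exists2 w, chains (A `|` [set y] `|` [set x]) w & chains A (u + bd w).
Proof.
move=> xy acL cA Ax Ay cAyx cAy Au Abu.
have Ayx : ~ (A `|` [set y]) x by case=> // xy'; case: xy; rewrite xy' ltxx.
have [a' [f [Aa' + def_u]]] := cone_decomposition (dclosed_not_lt cAy Ayx) Au.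
rewrite link_sdown // => xf.
have [a [b [Aa + def_a']]] := cone_decomposition (dclosed_not_lt cA Ay) Aa'.
rewrite link_sdown // => yb.
have [l [h [Ll yh def_f]]] := sdown_decomposition xy xf.
have bu : bd u = (bd a' + f) - cone x (bd f).
  by rewrite def_u raddfD /= bd_cone addrA.
have xA : sdown x `<=` A `|` [set y].
  by move=> z zx; have := zx; rewrite -(link_sdown cAyx) => -[].
have yA : sdown y `<=` A by move=> z zy; have := zy; rewrite -(link_sdown cAy) => -[].
have LA : sdown x `\ y `<=` A.
  by move=> z [/xA[]].
have bf0 : bd f = 0.
  apply: (@chains_cone_eq0 (A `|` [set y]) x) => //.
  have sAy := chains_subgroup (A `|` [set y]).
  have -> : cone x (bd f) = (bd a' + f) - bd u by rewrite bu opprB addrC subrK.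
  apply: sAy.2; last by apply: chains_sub Abu => z; left.
  by apply: (subgroupD sAy); [apply: chains_bd | apply: chains_sub xf].
have bh0 : h = bd b.
  apply/eqP; rewrite -subr_eq0; apply/eqP/(chains_cone_eq0 Ay).
  have -> : cone y (h - bd b) = bd u - (bd a + b + l).
    rewrite bu bf0 raddf0 subr0 def_f def_a' raddfB [bd (a + _)]raddfD /= bd_cone.
    by freeg_ring.
  apply: (chains_subgroup A).2 => //; apply: (subgroupD (chains_subgroup A)); last exact: chains_sub Ll.
  by apply: (subgroupD (chains_subgroup A)); [apply: chains_bd | apply: chains_sub yb].
have b_L : chains (sdown x `\ y) b.
  by apply: chains_sub yb; rewrite -(link_sdown2 xy) => z [].
have [||g Lg bg] := acL (l + b).
- exact: subgroupD (chains_subgroup _) Ll b_L.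
- have bh : bd h = 0 by rewrite bh0 bdK.
  by move: bf0; rewrite def_f !raddfD /= bd_cone bh raddf0 subr0 -bh0.
have xgb : chains (sdown x) (g - cone y b).
  apply: (chains_subgroup _).2; first by apply: chains_sub Lg => z [].
  apply: chains_cone; last by case: xy.
  apply: chains_sub yb => z zy; split=> //.
  by apply: lt_trans zy _; case: xy.
(* The boundary of [g - cone y b] is [f], so this cone cancels [cone y b + cone x f] and leaves
   [a + g], a chain of [A]. *)
exists (cone x (g - cone y b)).
  apply: chains_cone; last by right.
  by apply: chains_sub xgb => z zx; split=> //; left; apply: xA.
rewrite bd_cone raddfB /= bd_cone bg -bh0.
have -> : u + (g - cone y b - cone x (l + b - (b - cone y h))) = a + g.
  rewrite def_u def_a' def_f; have -> : l + b - (b - cone y h) = l + cone y h.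
    by freeg_ring.
  by freeg_ring.
by apply: (subgroupD (chains_subgroup A)) => //; apply: chains_sub Lg.
Qed.

End Chains.

(** * Flags, degrees and the spheres below the elements *)

Section Graded.
Context {d : Order.disp_t} {P : porderType d}.
Context (gP : graded P) (fP : finite_principal_ideals P).
Implicit Types (A B L : set P) (x y z : P) (s t : seq P) (u v : {freeg seq P}).

Lemma chain_uniq A s : chain A s -> uniq s.
Proof.
by move=> [ss _]; apply: sorted_uniq ss => [|x]; [exact: rev_trans lt_trans | exact: ltxx].
Qed.

Lemma chain_of_total A s :
  uniq s -> (forall x, x \in s -> A x) -> {in s &, forall x y, (x >=< y)%O} ->
  exists2 t, chain A t & t =i s.
Proof.
move=> us sA s_total; exists (rev (sort <=%O s)); last first.
  by move=> x; rewrite mem_rev mem_sort.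
split=> [|x]; last by rewrite mem_rev mem_sort => /sA.
rewrite rev_sorted lt_sorted_uniq_le sort_uniq us /=.
by apply: sort_sorted_in (allss s) => x y xs ys; apply: s_total.
Qed.

Lemma chain_bound A s : finite_set A -> chain A s -> (size s <= #|` fset_set A|)%N.
Proof.
move=> fA As; apply: (uniq_leq_size (chain_uniq As)) => x xs.
by rewrite in_fset_set // inE; apply: As.2.
Qed.

Lemma chain_comparable A s : chain A s -> {in s &, forall x y, (x >=< y)%O}.
Proof.
elim: s A => [|a s IHs] A // /chain_cons[_ As] x y.
rewrite !inE => /predU1P[->|xs] /predU1P[->|ys]; first exact: comparablexx.
- by rewrite comparable_sym; apply: lt_comparable; have [] := As.2 _ ys.
- by apply: lt_comparable; have [] := As.2 _ xs.
- exact: (IHs _ As).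
Qed.

Lemma has_degree_degree x : has_degree x (degree x).
Proof. by rewrite /degree; case: xgetP => // nox; have [n /nox] := gP x. Qed.

(** Since [down x] is finite, there is a longest chain containing [s]; it is a maximal chain, so the
    grading fixes its size. *)
Lemma maximal_chain_extends x s : chain (Defs.down x) s ->
  exists2 t, {subset s <= t} & chain (Defs.down x) t /\ size t = (degree x).+1.
Proof.
move=> xs.
pose Q n := `[< exists2 t, {subset s <= t} & chain (Defs.down x) t /\ size t = n >].
have Qs : exists n, Q n by exists (size s); apply/asboolP; exists s.
have Qbound n : Q n -> (n <= #|` fset_set (Defs.down x)|)%N.
  by move=> /asboolP[t _ [xt <-]]; apply: chain_bound.
have [n /asboolP[t st [xt tn]] maxn] := ex_maxnP Qs Qbound.
exists t => //; split=> //.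

have max_t : maximal_chain (Defs.down x) [set` t].
  split=> [y /= /(xt.2)//|y z yt zt|C Cx Ctot tC].
    by apply/orP; apply: (chain_comparable xt).
  rewrite eqEsubset; split=> // c Cc; apply: contrapT => /negP ct.
  have [|y|y z|t' xt' t't] := @chain_of_total (Defs.down x) (c :: t).
  - by rewrite /= ct (chain_uniq xt).
  - by rewrite inE => /predU1P[->|/(xt.2)//]; apply: Cx.
  - move=> yct zct; have tC' a : a \in c :: t -> C a.
      by rewrite inE => /predU1P[->//|/tC].
    by apply/orP; apply: Ctot; apply: tC'.
  have /maxn : Q n.+1.
    apply/asboolP; exists t' => [y ys|]; first by rewrite t't inE st ?orbT.
    split=> //; rewrite -tn; apply: (@perm_size _ t' (c :: t)).
    by apply: uniq_perm; rewrite /= ?ct ?(chain_uniq xt') ?(chain_uniq xt).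
  by rewrite ltnn.
rewrite -(card_fset_set (has_degree_degree max_t)).
apply: perm_size; apply: uniq_perm => [||y]; rewrite ?(chain_uniq xt) ?fset_uniq //.
by rewrite (in_fset_set (finite_seq t)); apply/idP/idP => yt; [exact: mem_set | exact: set_mem yt].
Qed.

Lemma chain_size x s : chain (Defs.down x) s -> (size s <= (degree x).+1)%N.
Proof.
move=> xs; have [t st [_ <-]] := maximal_chain_extends xs.
exact: uniq_leq_size (chain_uniq xs) st.
Qed.

Lemma chain_sdown x s : chain (sdown x) s -> chain (Defs.down x) (x :: s).
Proof.
move=> xs; apply/chain_cons; split; first exact: lexx.
by apply: chainS xs => y yx; split=> //; apply: ltW.
Qed.

Lemma chain_sdown_size x s : chain (sdown x) s -> (size s <= degree x)%N.
Proof. by move=> /chain_sdown/chain_size. Qed.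

Lemma degree_lt x y : (y < x)%O -> (degree y < degree x)%N.
Proof.
move=> yx; have [t _ [yt tn]] : exists2 t, {subset [::] <= t} &
    chain (Defs.down y) t /\ size t = (degree y).+1.
  by apply: maximal_chain_extends; split.
rewrite -tn; apply: chain_sdown_size; apply: chainS yt => z zy.
exact: le_lt_trans yx.
Qed.

(** A maximal chain below [x], top element first; in a graded poset its size characterizes it. *)
Definition flag x s := chain (sdown x) s /\ size s = degree x.

Lemma flag_exists x : exists s, flag x s.
Proof.
have [t _ [xt tn]] : exists2 t, {subset [:: x] <= t} &
    chain (Defs.down x) t /\ size t = (degree x).+1.
  apply: maximal_chain_extends; split=> // y.
  by rewrite inE => /eqP ->; apply: lexx.
case: t tn xt => // y t [tn] /chain_cons[yx yt].
exists t; split=> //; apply: chainS yt => z [_ /= zy].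
exact: lt_le_trans zy yx.
Qed.

Lemma hasse_degree x y : (y < x)%O -> degree x = (degree y).+1 -> hasse x y.
Proof.
move=> yx xy; split=> // -[z /andP[/degree_lt yz /degree_lt zx]].
by move: zx; rewrite xy ltnS leqNgt yz.
Qed.

Lemma flag_cons x y s : flag x (y :: s) -> hasse x y /\ flag y s.
Proof.
move=> [xys /= sn]; have [yx ys] := (chain_cons _ _ _).1 xys.
have {}ys : chain (sdown y) s by apply: chainS ys => z [].
have := chain_sdown_size ys; have := degree_lt yx; rewrite -sn ltnS => le1 le2.
have sy : size s = degree y by apply/eqP; rewrite eqn_leq le1 le2.
by split; [apply: hasse_degree; rewrite // -sn sy | split].
Qed.

Lemma flag_through x z : (z < x)%O -> exists y s, flag x (y :: s) /\ (z <= y)%O.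
Proof.
move=> zx; have [t zt [xt tn]] : exists2 t, {subset [:: x; z] <= t} &
    chain (Defs.down x) t /\ size t = (degree x).+1.
  apply: maximal_chain_extends; apply/chain_cons; split; first exact: lexx.
  by apply/chain_cons; split; [split=> //; apply: ltW | split].
case: t => [|a t] in zt xt tn *; first by have := zt x; rewrite inE eqxx => /(_ isT).
have [ax at_] := (chain_cons _ _ _).1 xt.
have a_x : a = x.
  apply/eqP; rewrite eq_le ax /=; have : x \in a :: t by rewrite zt // inE eqxx.
  by rewrite inE => /predU1P[->//|/(at_.2)[_ /ltW]].
have {at_} xt' : flag x t.
  split; last by case: tn.
  by apply: chainS at_ => b [_]; rewrite /= a_x.
have : z \in t.
  have : z \in a :: t by rewrite zt // !inE eqxx orbT.
  by rewrite inE a_x (lt_eqF zx).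
case: t xt' {zt xt tn} => // y t xyt; exists y, t; split=> //.
by move: H; rewrite inE => /predU1P[->//|/((flag_cons xyt).2.1.2)/ltW].
Qed.

Lemma lt_hasse x z : (z < x)%O -> exists2 y, hasse x y & (z <= y)%O.
Proof. by move=> /flag_through[y [s [/flag_cons[xy _] zy]]]; exists y. Qed.

Lemma degree_hasse x y : hasse x y -> degree x = (degree y).+1.
Proof.
move=> [yx noz]; have [z [s [xzs yz]]] := flag_through yx.
have [[zx _] [_ sz]] := flag_cons xzs.
have zy : z = y.
  apply: contrapT => /eqP zy; apply: noz; exists z.
  by rewrite zx andbT lt_neqAle eq_sym zy.
by rewrite -(xzs.2) /= sz zy.
Qed.

Context (acP : forall x y, hasse x y -> acyclic (sdown x `\ y)).



Lemma coeff_link x y s u : chains (sdown x `\ y) u -> coeff (y :: s) u = 0.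
Proof. by move=> Lu; apply: (coeff_unsupported Lu) => /chain_cons[[_ ny] _]; apply: ny. Qed.

Lemma chains_sdown2 x y : hasse x y -> chains (sdown y) `<=` chains (sdown x `\ y).
Proof. by move=> xy; apply: chains_sub; rewrite -(link_sdown2 xy) => z []. Qed.

Lemma chains_sdown_cone x y h :
  hasse x y -> chains (sdown y) h -> chains (sdown x) (cone y h).
Proof.
move=> xy yh; apply: chains_cone; last by case: xy.
by apply: chains_sub yh => z zy; split=> //; apply: lt_trans zy _; case: xy.
Qed.

(* With [flag_boundary], [sdown x] is a homology sphere whose fundamental cycle has
   a nonzero coefficient at every maximal chain.  Both go by induction on the flag:
   its top element [y] is a cone over [sdown y] glued to the acyclic [sdown x `\ y]. *)
Lemma flag_cycle x s : flag x s ->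
  exists u, [/\ chains (sdown x) u, bd u = 0 & coeff s u != 0].
Proof.
elim: s x => [|y s IHs] x xs.
  exists << [::] >>; split; first by apply: supported1; split.
    by rewrite bdU.
  by rewrite coeffU eqxx.
have [xy ys] := flag_cons xs; have [h [yh h0 hs]] := IHs _ ys.
have [g Lg bg] := acP xy (chains_sdown2 xy yh) h0.
exists (g - cone y h); split.
- apply: (chains_subgroup _).2; first by apply: chains_sub Lg => z [].
  exact: chains_sdown_cone.
- by rewrite raddfB /= bd_cone bg h0 raddf0 subr0 subrr.
by rewrite coeffB coeff_cone eqxx (coeff_link s Lg) sub0r oppr_eq0.
Qed.

Lemma flag_boundary x s u : flag x s -> chains (sdown x) u -> bd u = 0 ->
  coeff s u = 0 -> exists2 v, chains (sdown x) v & bd v = u.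
Proof.
elim: s x u => [|y s IHs] x u xs xu u0 us.
  suff -> : u = 0 by exists 0; [case: (chains_subgroup (sdown x)) | rewrite raddf0].
  apply: freegP => t; rewrite coeff0; apply: contrapT => /eqP ut.
  have := chain_sdown_size (xu _ ut); rewrite -(xs.2) leqn0 => /nilP t0.
  by rewrite t0 us eqxx in ut.
have [xy ys] := flag_cons xs.
have [l [h [Ll yh def_u]]] := sdown_decomposition xy xu.
have bu : bd u = (bd l + h) - cone y (bd h).
  by rewrite def_u raddfD /= bd_cone addrA.
have ny : ~ (sdown x `\ y) y by case=> _; apply.
have bh : bd h = 0.
  apply: (chains_cone_eq0 ny).
  have -> : cone y (bd h) = bd l + h - bd u by rewrite bu opprB addrC subrK.
  rewrite u0 subr0; apply: (subgroupD (chains_subgroup _)); first exact: chains_bd.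
  exact: chains_sdown2.
have hs : coeff s h = 0.
  by rewrite -us def_u coeffD coeff_cone eqxx (coeff_link s Ll) add0r.
have [k yk bk] := IHs _ _ ys yh bh hs.
have [||g Lg bg] := acP xy (u := l + k).
- by apply: (subgroupD (chains_subgroup _)) => //; apply: chains_sdown2.
- by rewrite raddfD /= bk; move: u0; rewrite bu bh raddf0 subr0.
exists (g - cone y k).
  apply: (chains_subgroup _).2; first by apply: chains_sub Lg => z [].
  exact: chains_sdown_cone.
by rewrite raddfB /= bd_cone bg bk def_u; freeg_ring.
Qed.

(* Otherwise [y :: z :: s] would be the only chain of the fundamental cycle of
   [sdown x] with [z :: s] in its boundary, for [s] a flag of [z]. *)
Lemma diamond x y z : hasse x y -> hasse y z ->
  exists y', [/\ (z < y')%O, (y' < x)%O & y' <> y].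
Proof.
move=> xy yz; have [s zs] := flag_exists z.
have dy := degree_hasse yz; have dx := degree_hasse xy.

have yzs : flag y (z :: s).
  split; last by rewrite /= zs.2 dy.
  apply/chain_cons; split; first by case: yz.
  apply: chainS (zs.1) => b bz; split=> //; apply: lt_trans bz _; by case: yz.
have xyzs : flag x (y :: z :: s).
  split; last by rewrite /= zs.2 dx dy.
  apply/chain_cons; split; first by case: xy.
  apply: chainS (yzs.1) => b bz; split=> //; apply: lt_trans bz _; by case: xy.
have [u [xu u0 us]] := flag_cycle xyzs.
have [l [h [Ll yh def_u]]] := sdown_decomposition xy xu.
have ny : ~ (sdown x `\ y) y by case=> _; apply.
have zy : z != y by have [zy _] := yz; rewrite (lt_eqF zy).
have hs : coeff (z :: s) h != 0.
  by move: us; rewrite def_u coeffD coeff_cone eqxx (coeff_link (z :: s) Ll) add0r.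
have : coeff (z :: s) (bd l) != 0.
  move: (congr1 (coeff (z :: s)) u0); rewrite coeff0 def_u raddfD /= bd_cone.
  rewrite coeffD coeffB coeff_cone (negbTE zy) subr0 => /eqP.
  by rewrite addr_eq0 => /eqP ->; rewrite oppr_eq0.
move=> /(bd_supported Ll)[t [Lt ts tn]].
case: t => // w t in Lt ts tn *.
have [[wx wy] wt] := (chain_cons _ _ _).1 Lt.
exists w; split=> //.
have : z \in w :: t by apply: (mem_subseq ts); rewrite inE eqxx.
rewrite inE => /predU1P[zw|/(wt.2)[]//].
have : chain (sdown z) t by apply: chainS wt => b [_ /=]; rewrite -zw.
by move=> /chain_sdown_size; move: tn => /= -[->]; rewrite zs.2 ltnn.
Qed.

End Graded.

(** * Adding matched pairs and critical elements *)

Section Attach.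
Context {d : Order.disp_t} {P : porderType d}.
Implicit Types (A B C : set P) (x y z : P) (s t : seq P) (u v w : {freeg seq P}).

(* Unreduced homology: in this complex [chains set0] is spanned by the empty
   chain, so that a 0-dimensional chain is always a cycle. *)
Definition cyc n A : set {freeg seq P} :=
  [set u | chainsn n.+1 A u /\ chains set0 (bd u)].
Definition bnd n A : set {freeg seq P} := [set bd w | w in chainsn n.+2 A].
Definition hrank n A r := has_rank (cyc n A) (bnd n A) r.

Lemma chainsn_subgroup n A : subgroup (chainsn n A).
Proof. exact: supported_subgroup. Qed.

Lemma cyc_subgroup n A : subgroup (cyc n A).
Proof.
split=> [|u v [Au u0] [Av v0]].
  split; first exact: (chainsn_subgroup _ _).1.
  by rewrite raddf0; apply: (chains_subgroup _).1.
split; first exact: (chainsn_subgroup _ _).2.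
by rewrite raddfB; apply: (chains_subgroup _).2.
Qed.

Lemma bnd_subgroup n A : subgroup (bnd n A).
Proof.
split=> [|_ _ [v Av <-] [w Aw <-]].
  by exists 0; [exact: (chainsn_subgroup _ _).1 | rewrite raddf0].
by exists (v - w); [exact: (chainsn_subgroup _ _).2 | rewrite raddfB].
Qed.

Lemma cycS n A B : A `<=` B -> cyc n A `<=` cyc n B.
Proof. by move=> AB u [Au u0]; split=> //; apply: chainsnS Au. Qed.

Lemma bndS n A B : A `<=` B -> bnd n A `<=` bnd n B.
Proof. by move=> AB _ [w Aw <-]; exists w => //; apply: chainsnS Aw. Qed.

Lemma chainsn_set0 n u : chainsn n.+1 set0 u -> u = 0.
Proof.
move=> u0; apply: freegP => s; rewrite coeff0; apply: contrapT => /eqP /u0[[_ s0]].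
by case: s s0 => // x s /(_ x); rewrite inE eqxx => /(_ isT).
Qed.

Lemma chainsn_chainsI n A B u : chainsn n A u -> chains B u -> chainsn n B u.
Proof. by move=> Au Bu s us; split; [exact: Bu | have [] := Au s us]. Qed.

Lemma cyc_bd n A u : cyc n.+1 A u -> bd u = 0.
Proof.
by move=> [/chainsn_bd Au u0]; apply: chainsn_set0 (chainsn_chainsI Au u0).
Qed.

Lemma bd_cyc n A u : chainsn n.+1 A u -> bd u = 0 -> cyc n A u.
Proof. by move=> Au u0; split; rewrite ?u0 //; apply: (chains_subgroup _).1. Qed.

(** Injectivity of [H_n(A) -> H_n(B)] is required only up to a nonzero factor; [attach_critical]
    uses this with the factor [lam c]. *)
Lemma hrank_transfer n A B r : A `<=` B ->
  (forall u, cyc n B u -> exists2 w, chainsn n.+2 B w & chains A (u + bd w)) ->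
  (forall v, chainsn n.+2 B v -> chains A (bd v) ->
     exists2 m : int, m != 0 & bnd n A (bd v *~ m)) ->
  hrank n A r -> hrank n B r.
Proof.
move=> AB onto inj; apply: has_rank_commensurable => [|||||u [Bu u0]|u [Au u0] [v Bv uv]].
- exact: cyc_subgroup.
- exact: cyc_subgroup.
- exact: bnd_subgroup.
- exact: cycS.
- exact: bndS.
- have [w Bw Aw] := onto u (conj Bu u0).
  exists 1 => //; exists (u + bd w).
    split; last by rewrite raddfD /= bdK addr0.
    apply: chainsn_chainsI Aw; apply: (subgroupD (chainsn_subgroup _ B)) => //.
    exact: chainsn_bd.
  rewrite mulr1z opprD addNKr -raddfN; exists (- w) => //.
  exact: (subgroupN (chainsn_subgroup _ _)).
- rewrite -uv; apply: inj => //; rewrite uv; exact: chainsn_chains Au.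
Qed.

(** Vanishing of the relative group [H_n(B, A)], expressed by representatives. *)
Definition rel_acyclic n A B := forall u, chainsn n.+1 B u -> chains A (bd u) ->
  exists2 w, chainsn n.+2 B w & chains A (u + bd w).

Lemma rel_acyclic_trans n A B C : A `<=` B -> B `<=` C ->
  rel_acyclic n A B -> rel_acyclic n B C -> rel_acyclic n A C.
Proof.
move=> AB BC accAB accBC u Cu Au.
have [w Cw Bw] := accBC u Cu (chains_sub AB Au).
have [|//|w' Bw' Aw'] := accAB (u + bd w).
- apply: chainsn_chainsI Bw; apply: (subgroupD (chainsn_subgroup _ C)) => //.
  exact: chainsn_bd.
- by rewrite raddfD /= bdK addr0.
exists (w + w'); last by rewrite raddfD /= addrA.
by apply: (subgroupD (chainsn_subgroup _ C)) => //; apply: chainsnS Bw'.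
Qed.

Lemma rel_acyclic_refl n A : rel_acyclic n A A.
Proof.
move=> u Au _; exists 0; first exact: (chainsn_subgroup _ _).1.
by rewrite raddf0 addr0; apply: chainsn_chains Au.
Qed.

(** In the long exact sequence of the pair, [acc0] makes [H_n(A) -> H_n(B)] surjective and [acc1]
    makes it injective. *)
Lemma hrank_rel_acyclic n A B r : A `<=` B ->
  rel_acyclic n A B -> rel_acyclic n.+1 A B -> hrank n A r -> hrank n B r.
Proof.
move=> AB acc0 acc1; apply: hrank_transfer => // [u [Bu u0]|v Bv Av].
  by apply: acc0 => //; apply: chains_sub u0.
have [w Bw Aw] := acc1 v Bv Av; exists 1 => //; rewrite mulr1z.
exists (v + bd w); last by rewrite raddfD /= bdK addr0.
apply: chainsn_chainsI Aw; apply: (subgroupD (chainsn_subgroup _ B)) => //.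
exact: chainsn_bd.
Qed.

(** The cone arguments mix all degrees; taking the homogeneous part of their output recovers a
    statement in one degree. *)
Lemma graded_relative A B k u : chainsn k B u ->
  (exists2 w, chains B w & chains A (u + bd w)) ->
  exists2 w, chainsn k.+1 B w & chains A (u + bd w).
Proof.
move=> Bu [w Bw Aw]; exists (proj k.+1 w); first exact: proj_chains.
have -> : u + bd (proj k.+1 w) = proj k (u + bd w).
  by rewrite raddfD /= (proj_id Bu) proj_bd.
exact: chainsn_chains (proj_chains Aw).
Qed.

Lemma pair_rel_acyclic n A x y : hasse x y -> acyclic (sdown x `\ y) ->
  dclosed A -> ~ A x -> ~ A y -> dclosed (A `|` [set y] `|` [set x]) ->
  rel_acyclic n A (A `|` [set y] `|` [set x]).
Proof.
move=> xy acL cA Ax Ay cAyx u Au Abu; apply: graded_relative => //.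
apply: pair_relative => //; last exact: chainsn_chains Au.
move=> a b Aya ba; have [//|/= bx] := cAyx a b (or_introl Aya) ba.
move: ba; rewrite bx => xa; case: Aya => [Aa|/= ay]; first by case: Ax; apply: cA xa.
by case: xy => yx _; move: (lt_le_trans yx xa); rewrite ay ltxx.
Qed.

Context (gP : graded P) (fP : finite_principal_ideals P).
Context (acP : forall x y, hasse x y -> acyclic (sdown x `\ y)).

Section Critical.
Context (A : set P) (x : P).
Context (cA : dclosed A) (cAx : dclosed (A `|` [set x])) (Ax : ~ A x).
Context (s : seq P) (xs : flag x s).
Local Notation Ax' := (A `|` [set x]).
(** The relative homology of [(Ax', A)] has rank one and sits in degree [degree x]. [lam] is a
    coordinate on it: a relative cycle with [lam] zero is trivial by [critical_relative], and
    [critical_cycle] provides one with [lam] nonzero. *)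
Local Notation lam := (coeff (x :: s)).

Let sdown_A : sdown x `<=` A.
Proof. by move=> z; rewrite -(link_sdown cAx) => -[]. Qed.

Lemma lam_chains u : chains A u -> lam u = 0.
Proof. by move=> Au; apply: (coeff_unsupported Au) => /chain_cons[/Ax]. Qed.

(** In [u = a + cone x f] the chain [f] is a cycle below [x] whose coefficient at the flag [s] is
    [lam u]; once this vanishes, [flag_boundary] fills [f]. *)
Lemma critical_relative u : chains Ax' u -> chains A (bd u) -> lam u = 0 ->
  exists2 w, chains Ax' w & chains A (u + bd w).
Proof.
move=> Au Abu lu.
have [a [f [Aa + def_u]]] := cone_decomposition (dclosed_not_lt cA Ax) Au.
rewrite link_sdown // => xf.
have bu : bd u = (bd a + f) - cone x (bd f).
  by rewrite def_u raddfD /= bd_cone addrA.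
have Af := chains_sub sdown_A xf.
have bf : bd f = 0.
  apply: (chains_cone_eq0 Ax).
  have -> : cone x (bd f) = bd a + f - bd u by rewrite bu opprB addrC subrK.
  apply: (chains_subgroup _).2 => //; apply: (subgroupD (chains_subgroup _)) => //.
  exact: chains_bd.
have fs : coeff s f = 0.
  by move: lu; rewrite def_u coeffD coeff_cone eqxx lam_chains ?add0r.
have [v xv bv] := flag_boundary gP fP acP xs xf bf fs.
exists (cone x v).
  apply: chains_cone; last by right.
  by apply: chains_sub xv => z zx; split=> //; left; apply: sdown_A.
have -> : u + bd (cone x v) = a + v.
  by rewrite bd_cone bv def_u; freeg_ring.
by apply: (subgroupD (chains_subgroup _)) => //; apply: chains_sub xv.
Qed.

Lemma critical_relativen k u : chainsn k Ax' u -> chains A (bd u) -> lam u = 0 ->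
  exists2 w, chainsn k.+1 Ax' w & chains A (u + bd w).
Proof.
move=> Au Abu lu; apply: graded_relative => //.
by apply: critical_relative => //; apply: chainsn_chains Au.
Qed.

Lemma lam_chainsn k u : k != degree x -> chainsn k.+1 Ax' u -> lam u = 0.
Proof.
move=> kx Au; apply: (coeff_unsupported Au) => -[_ /= [sk]].
by move: kx; rewrite -sk xs.2 eqxx.
Qed.

Lemma critical_rel_acyclic k : k != degree x -> rel_acyclic k A Ax'.
Proof.
move=> kx u Au Abu; apply: critical_relativen => //; exact: lam_chainsn Au.
Qed.

(** A chain through [x] has [x] on top and at most [degree x] elements under it. *)
Lemma critical_top u : chainsn (degree x).+2 Ax' u -> chainsn (degree x).+2 A u.
Proof.
apply: supported_sub => -[|y t] [At /= sz] //; split=> //.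
have [Ay ty] := (chain_cons _ _ _).1 At; case: Ay => [Ay|/= yx].
  split; first exact: At.1.
  move=> z; rewrite inE => /predU1P[-> //|/(ty.2)[[//|/= ->]]].
  by move=> xy; have := dclosed_not_lt cA Ax Ay; rewrite xy.
have : chain (sdown x) t by apply: chainS ty => z [_]; rewrite yx.
by move=> /(chain_sdown_size gP fP); case: sz => ->; rewrite ltnn.
Qed.

(** The cone over the fundamental cycle of [sdown x], made homogeneous by [proj]. *)
Lemma critical_cycle : exists u,
  [/\ chainsn (degree x).+1 Ax' u, chains A (bd u) & lam u != 0].
Proof.
have [f [xf bf fs]] := flag_cycle gP fP acP xs.
exists (cone x (proj (degree x) f)); split.
- move=> [|y t]; rewrite coeff_cone ?eqxx //.
  have [->|_] := eqVneq y x; last by rewrite eqxx.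
  rewrite coeff_proj; have [tx|_] := eqVneq (size t) (degree x); last by rewrite eqxx.
  move=> /xf xt; split; last by rewrite /= tx.
  apply/chain_cons; split; first by right.
  by apply: chainS xt => z zx; split=> //; left; apply: sdown_A.
- rewrite bd_cone; case dx: (degree x) => [|k].
    rewrite (chainsn0_bd (proj_chains xf)) raddf0 subr0.
    by apply: chains_sub (chainsn_chains (proj_chains xf)).
  rewrite proj_bd bf [proj _ 0]raddf0 [cone _ 0]raddf0 subr0.
  by apply: chains_sub (chainsn_chains (proj_chains xf)).
- by rewrite coeff_cone eqxx coeff_proj xs.2 eqxx.
Qed.

(* [H_n] grows if some cycle of degree [n] involves [x]; otherwise the boundary of
   the new relative cycle has infinite order in [H_(n-1)], and is killed. *)
Lemma attach_critical (beta : nat -> nat) : (forall n, hrank n A (beta n)) ->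
  exists2 beta', forall n, hrank n Ax' (beta' n) &
    (forall n, beta' n = beta n + (n == degree x))%N \/
    (exists2 k, degree x = k.+1 & forall n, beta n = beta' n + (n == k))%N.
Proof.
set n := degree x => hA.
have AAx : A `<=` Ax' by left.
have chA := chains_subgroup A.
have far k : k != n -> k.+1 != n -> hrank k Ax' (beta k).
  move=> kn kn1; apply: hrank_rel_acyclic (hA k) => //; exact: critical_rel_acyclic.
have onto k u : k != n -> cyc k Ax' u ->
    exists2 w, chainsn k.+2 Ax' w & chains A (u + bd w).
  move=> kn [Au u0]; apply: critical_rel_acyclic => //.
  exact: chains_sub u0.
(* The combination [v *~ lam v' - v' *~ lam v] has [lam] zero, so it can be pushed into [A] without
   changing its boundary. *)
have lam_combination v v' : chainsn n.+1 Ax' v -> chainsn n.+1 Ax' v' ->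
    chains A (bd v) -> chains A (bd v') ->
    exists2 w, chainsn n.+1 A w & bd w = bd v *~ lam v' - bd v' *~ lam v.
  move=> Av Av' Abv Abv'; pose u := v *~ lam v' - v' *~ lam v.
  have bu : bd u = bd v *~ lam v' - bd v' *~ lam v by rewrite raddfB !raddfMz.
  have Au : chainsn n.+1 Ax' u.
    by apply: (chainsn_subgroup _ _).2; apply: (subgroupMz _ (chainsn_subgroup _ _)).
  have [||w Aw Auw] := critical_relativen Au.
  - by rewrite bu; apply: chA.2; apply: (subgroupMz _ chA).
  - by rewrite raddfB !raddfMz /= !mulrzz mulNr mulrC subrr.
  exists (u + bd w); last by rewrite raddfD /= bdK addr0.
  apply: chainsn_chainsI Auw; apply: (subgroupD (chainsn_subgroup _ Ax')) => //.
  exact: chainsn_bd.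
have [[c [Ac c0 lc]]|noc] := pselect (exists c,
    [/\ chainsn n.+1 Ax' c, chains set0 (bd c) & lam c != 0]).
  exists (fun k => beta k + (k == n))%N; last by left.
  move=> k; have [->|kn] := eqVneq k n.
    (* [lam] vanishes on boundaries and not on [c]; its kernel in [H_n(Ax')] is the image of
       [H_n(A)]. *)
    rewrite addn1; apply: (@has_rank_succ _ _ _ _ lam c) => //.
    - exact: cyc_subgroup.
    - by move=> _ [w /critical_top Aw <-]; apply/lam_chains/chains_bd/chainsn_chains/Aw.
    apply: has_rank_commensurable (hA n).
    - exact: cyc_subgroup.
    - apply: subgroupI; first exact: cyc_subgroup.
      split=> [|u v /= u0 v0]; first exact: coeff0.
      by rewrite /= coeffB u0 v0 subrr.
    - exact: bnd_subgroup.
    - by move=> u Au; split; [exact: cycS Au | exact/lam_chains/chainsn_chains/Au.1].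
    - exact: bndS.
    - move=> u [[Au u0] lu]; exists 1 => //.
      have [w Aw Aw'] := critical_relativen Au (chains_sub (@sub0set _ A) u0) lu.
      exists (u + bd w).
        split; last by rewrite raddfD /= bdK addr0.
        apply: chainsn_chainsI Aw'; apply: (subgroupD (chainsn_subgroup _ Ax')) => //.
        exact: chainsn_bd.
      rewrite mulr1z opprD addNKr -raddfN; exists (- w) => //.
      exact: (subgroupN (chainsn_subgroup _ _)).
    - move=> u [Au u0] [w /critical_top Aw <-]; exists 1 => //.
      by rewrite mulr1z; exists w.
  rewrite addn0; have [kn1|] := eqVneq k.+1 n; last exact: far.
  apply: hrank_transfer (hA k) => // [u|v Av Abv]; first exact: onto.
  (* As [bd c = 0], combining [v] with [c] writes [lam c] times [bd v] as a boundary from [A]. *)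
  exists (lam c) => //.
  have c0' : bd c = 0 by apply: (@cyc_bd k Ax'); split=> //; rewrite kn1.
  have [||||w Aw bw] := lam_combination v c; rewrite -?kn1 //.
  - by rewrite kn1.
  - by rewrite c0'; apply: chA.1.
  by exists w; rewrite ?kn1 // bw c0' mul0rz subr0.
have lam_cyc u : cyc n Ax' u -> lam u = 0.
  by move=> [Au u0]; apply: contrapT => /eqP lu; apply: noc; exists u.
have [u0 [Au0 bu0 lu0]] := critical_cycle.
have hn : hrank n Ax' (beta n).
  apply: hrank_transfer (hA n) => // [u Au|v Av _].
    have [Au' u'0] := Au; apply: critical_relativen => //; last exact: lam_cyc.
    exact: chains_sub u'0.
  by exists 1 => //; rewrite mulr1z; exists v => //; apply: critical_top.
case n0 : n => [|k].
  (* In degree 0 the cycle condition tolerates multiples of the empty chain, so [u0] would be a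
     cycle with nonzero [lam]. *)
  exfalso; move: lu0; rewrite lam_cyc ?eqxx //; split=> //.
  rewrite -/n n0 in Au0; apply: supported_sub (chainsn_bd Au0) => t [At /size0nil ->].
  by split.
have Au0' : chainsn k.+2 Ax' u0 by rewrite -n0.

have cyc_bu0 : cyc k A (bd u0).
  by apply: bd_cyc; [exact: chainsn_chainsI (chainsn_bd Au0') bu0 | exact: bdK].
have sT' : subgroup (cyc k A `&` bnd k Ax').
  by apply: subgroupI; [exact: cyc_subgroup | exact: bnd_subgroup].
(* Up to torsion, [bd u0] generates the kernel of [H_k(A) -> H_k(Ax')]. *)
have [||m|u Au [_ [v Av uv]]|r' br' hr'] := has_rank_pred (@cyc_subgroup k A)
    (@bnd_subgroup k A) sT' _ cyc_bu0 _ _ _ (hA k).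
- move=> _ [w Aw <-]; split; last by exists w => //; apply: chainsnS Aw.
  by apply: bd_cyc; [exact: chainsn_bd | exact: bdK].
- by split=> //; exists u0.
(* If [m] times [bd u0] bounds [w] in [A], then [u0 *~ m - w] is a cycle with [lam] equal to
   [m * lam u0], so [m = 0]. *)
- move=> [w Aw bw]; have : lam (u0 *~ m - w) = 0.
    apply: lam_cyc; split.
      apply: (chainsn_subgroup _ _).2; last by rewrite n0; apply: chainsnS Aw.
      exact: (subgroupMz _ (chainsn_subgroup _ _)).
    by rewrite raddfB raddfMz /= bw subrr; apply: (chains_subgroup _).1.
  rewrite raddfB raddfMz /= (lam_chains (chainsn_chains Aw)) subr0.
  by move=> /eqP; rewrite mulrzz mulf_eq0 (negbTE lu0) => /eqP.
- exists (lam u0) => //; exists (lam v).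
  rewrite -uv; have [||||w Aw bw] := lam_combination v u0; rewrite ?n0 //.
    by rewrite uv; apply: chainsn_chains Au.1.
  by exists w; rewrite // -n0.
exists (fun i => if i == k then r' else beta i) => [i|]; last first.
  by right; exists k => // i; case: eqP => [->|_]; rewrite ?addn0 // br' addn1.
case: eqP => [->|/eqP ik].
  apply: has_rank_commensurable hr'.
  - exact: cyc_subgroup.
  - exact: cyc_subgroup.
  - exact: bnd_subgroup.
  - exact: cycS.
  - by move=> u [].
  - move=> u Au; have [|w Aw Auw] := onto k u _ Au; first by rewrite n0 ltn_eqF.
    exists 1 => //; exists (u + bd w).
      split; last by rewrite raddfD /= bdK addr0; case: Au.
      apply: chainsn_chainsI Auw; apply: (subgroupD (chainsn_subgroup _ Ax')).
        by case: Au.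
      exact: chainsn_bd.
    rewrite mulr1z opprD addNKr -raddfN; exists (- w) => //.
    exact: (subgroupN (chainsn_subgroup _ _)).
  - by move=> u Au uT; exists 1 => //; rewrite mulr1z.
have [->|iN] := eqVneq i n; first exact: hn.
by apply: far => //; rewrite n0 eqSS.
Qed.

End Critical.
End Attach.

(** * Rays and their reversal *)

Section Walks.
Context {T : Type} (e : rel T).
Implicit Types (v w : T) (s : nat -> T).

Definition reach v w := exists2 p, path e v p & last v p = w.
Definition walk s := forall i, e (s i) (s i.+1).

Lemma reach_refl v : reach v v. Proof. by exists [::]. Qed.

Lemma reach_trans u v w : reach u v -> reach v w -> reach u w.
Proof.
move=> [p up <-] [q pq <-]; exists (p ++ q); last by rewrite last_cat.
by rewrite cat_path up.
Qed.

Lemma reach1 v w : e v w -> reach v w.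
Proof. by move=> vw; exists [:: w]; rewrite //= vw. Qed.

Lemma walk_reach s i j : walk s -> (i <= j)%N -> reach (s i) (s j).
Proof.
move=> ws /subnK <-; elim: (j - i)%N => [|k IHk]; first exact: reach_refl.
by rewrite addSn; apply: reach_trans IHk (reach1 _).
Qed.

Definition noreturn := forall v w, e v w -> ~ reach w v.

Lemma walk_injective s : noreturn -> walk s -> injective s.
Proof.
move=> acyc ws; suff lt i j : (i < j)%N -> s i <> s j.
  move=> i j sij; case: (ltngtP i j) => // [/lt//|/lt]; by rewrite sij.
by move=> ij sij; apply: (acyc _ _ (ws i)); rewrite sij; apply: walk_reach.
Qed.

(** A vertex that is not accessible has a successor that is not accessible either; dependent choice
    turns this into a walk. *)
Lemma no_walk_well_founded :
  (forall s, ~ walk s) -> well_founded (fun w v => e v w).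
Proof.
move=> now v; apply: contrapT => nv.
have next w : exists w', ~ Acc (fun w v => e v w) w ->
    e w w' /\ ~ Acc (fun w v => e v w) w'.
  have [aw|naw] := pselect (Acc (fun w v => e v w) w); first by exists w.
  apply: contrapT => now'; apply: naw; split=> w' ww'.
  by apply: contrapT => nw'; apply: now'; exists w'.
have [f fP] := choice next; pose s i := iter i f v.
have sP i : ~ Acc (fun w v => e v w) (s i).
  by elim: i => // i IHi; case: (fP _ IHi).
by apply: (now s) => i; case: (fP _ (sP i)).
Qed.

(* At the [i]-th branching point the walk avoids the next step of [rho i]. *)
Lemma diagonal_walk (V : set T) (rho : nat -> nat -> T) v0 :
  (forall i, injective (rho i)) ->
  (forall v, V v -> exists g, reach v g /\
     exists z1 z2, [/\ z1 <> z2, e g z1 /\ e g z2 & V z1 /\ V z2]) ->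
  V v0 ->
  exists2 s, walk s &
    forall i, exists2 t, (i <= t)%N & forall p, rho i p = s t -> rho i p.+1 <> s t.+1.
Proof.
move=> rho_inj branch Vv0.
pose good i g z := forall p, rho i p = g -> rho i p.+1 <> z.
have next vi : exists qz : seq T * T, V vi.1 ->
    [/\ path e vi.1 qz.1, e (last vi.1 qz.1) qz.2, V qz.2 &
        good vi.2 (last vi.1 qz.1) qz.2].
  have [Vv|nVv] := pselect (V vi.1); last by exists ([::], vi.1).
  have [g [[q vq qg] [z1 [z2 [z12 [gz1 gz2] [Vz1 Vz2]]]]]] := branch _ Vv.
  (* [rho i] is injective and passes [g] at most once, so [z1] and [z2] cannot both be its next
     vertex. *)
  have [gd|ngd] := pselect (good vi.2 g z1).
    by exists (q, z1) => _ /=; rewrite qg.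
  exists (q, z2) => _ /=; rewrite qg; split=> // p pg pz2; apply: ngd => p' p'g p'z1.
  by apply: z12; rewrite -p'z1 -pz2; congr (rho _ _.+1); apply: (rho_inj vi.2); rewrite p'g pg.
have [F FP] := choice next.
(* A state consists of the current vertex, the path left to the next branching
   point, the vertex chosen after it, and the number of branchings passed. *)
pose start v i := (v, (F (v, i)).1, (F (v, i)).2, i).
pose step (st : T * seq T * T * nat) := let: (v, q, z, i) := st in
  if q is a :: q' then (a, q', z, i) else start z i.+1.
pose S t := iter t step (start v0 0%N).
pose inv (st : T * seq T * T * nat) := let: (v, q, z, i) := st in
  [/\ path e v q, e (last v q) z, V z & good i (last v q) z].
have startP v i : V v -> inv (start v i) by exact: FP (v, i).
have invS t : inv (S t).
  elim: t => [|t]; first exact: startP.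
  rewrite /S iterS -/(S t); case: (S t) => -[[v [|a q]] z] i /= [vq qz Vz gd].
    exact: startP.
  by case/andP: vq => _ aq.
exists (fun t => (S t).1.1.1) => [t|i].
  rewrite /S iterS -/(S t); have := invS t.
  by case: (S t) => -[[v [|a q]] z] i /= [] // /andP[].
have stage_le t : ((S t).2 <= t)%N.
  elim: t => // t; rewrite /S iterS -/(S t).
  by case: (S t) => -[[v [|a q]] z] j //= jt; apply: leqW.
have finish t v q z j : S t = (v, q, z, j) -> S (t + size q)%N = (last v q, [::], z, j).
  elim: q t v => [|a q IHq] t v St /=; first by rewrite addn0.
  rewrite addnS -addSn; apply: (IHq t.+1 a).
  by rewrite /S iterS -/(S t) St.
suff [t [z St]] : exists t z, (S t).1 = ((S t).1.1.1, [::], z) /\ (S t).2 = i.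
  exists t; first by rewrite -St.2; apply: stage_le.
  have := invS t; rewrite /S iterS -/(S t).
  by case: (S t) St => -[[v q] z'] j /= [[-> ->] ->] [].
have done_stage t : (S t).2 = i -> exists t z, (S t).1 = ((S t).1.1.1, [::], z) /\ (S t).2 = i.
  case St : (S t) => [[[v q] z] j] /= ij.
  by exists (t + size q)%N, z; rewrite (finish _ _ _ _ _ St).
elim: i done_stage => [|i IHi] done_stage; first exact: (done_stage 0%N).
have [t [z [St Si]]] : exists t z, (S t).1 = ((S t).1.1.1, [::], z) /\ (S t).2 = i.
  apply: IHi => t; case St : (S t) => [[[v q] z] j] /= ij.
  by exists (t + size q)%N, z; rewrite (finish _ _ _ _ _ St).
apply: (done_stage t.+1); rewrite /S iterS -/(S t).
by case: (S t) St Si => -[[v q] z'] j /= [-> _] ->.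
Qed.

End Walks.

Lemma antitone_stabilizes (T : choiceType) (F : nat -> set T) :
  (forall n, F n.+1 `<=` F n) -> finite_set (F 0%N) ->
  exists K, forall n, (K <= n)%N -> F n = F K.
Proof.
move=> Fdec F0; have Fle m n : (m <= n)%N -> F n `<=` F m.
  move=> /subnK <-; elim: (n - m)%N => // k IHk; rewrite addSn.
  exact: subset_trans (Fdec _) IHk.
have Ffin n : finite_set (F n) by apply: sub_finite_set F0; apply: Fle.
pose Q k := `[< exists n, #|` fset_set (F n)| = k >].
have exQ : exists k, Q k by exists #|` fset_set (F 0%N)|; apply/asboolP; exists 0%N.
have [k /asboolP[K FK] mink] := ex_minnP exQ.
exists K => n Kn; apply: fset_set_inj; rewrite ?inE //; apply/eqP.
rewrite eqEfcard FK mink ?andbT; last by apply/asboolP; exists n.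
by rewrite -fset_set_sub //; apply: Fle.
Qed.

(** * Rays without detours *)

Section Rays.
Context {d : Order.disp_t} {P : porderType d}.
Context (gP : graded P) (fP : finite_principal_ideals P).
Context (M : set (P * P)) (morseM : morse_matching M).
Implicit Types (v w x y z : P) (r s : nat -> P) (C : set (nat -> P)).
Local Notation e := (marrow M).
Local Notation reach := (reach (marrow M)).

Lemma matching_eq a b v : M a -> M b ->
  (v = a.1 \/ v = a.2) -> (v = b.1 \/ v = b.2) -> a = b.
Proof. exact: morseM.1.2. Qed.

Lemma matching_hasse x y : M (x, y) -> hasse x y.
Proof. exact: morseM.1.1. Qed.

Lemma marrowP v w : e v w <-> (hasse v w /\ ~ M (v, w)) \/ M (w, v).
Proof. by split=> [/asboolP|?]; last exact/asboolP. Qed.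

Lemma morse_noreturn : noreturn e.
Proof.
move=> v w vw [p wp pv].
have : cycle e (v :: belast w p) by rewrite /= -pv -lastI /= pv vw.
by move/(morseM.2).
Qed.

Lemma walk_ray s : walk e s -> ray M s.
Proof. by move=> ws; split=> //; apply: walk_injective ws; apply: morse_noreturn. Qed.

Definition tail j r : nat -> P := fun i => r (j + i)%N.

Lemma tail_ray j r : ray M r -> ray M (tail j r).
Proof. by move=> [_ wr]; apply: walk_ray => i; rewrite /tail addnS. Qed.

Lemma ray_equiv_refl r : ray_equiv r r.
Proof. by exists 0%N, 0%N. Qed.

Lemma ray_equiv_sym r s : ray_equiv r s -> ray_equiv s r.
Proof. by move=> [K [N rs]]; exists N, K => i; rewrite rs. Qed.

Lemma ray_equiv_trans r s t : ray_equiv r s -> ray_equiv s t -> ray_equiv r t.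
Proof.
move=> [K [N rs]] [K' [N' st]]; exists (K + K')%N, (N' + N)%N => i.
by rewrite -addnA rs addnCA st addnA.
Qed.

Lemma tail_equiv j r : ray_equiv r (tail j r).
Proof. by exists j, 0%N. Qed.

Lemma ray_class_eq r s : ray_equiv r s -> ray_class M r = ray_class M s.
Proof.
move=> rs; rewrite predeqE => t; split=> -[rt ?]; split=> //.
  exact: ray_equiv_trans (ray_equiv_sym rs) _.
exact: ray_equiv_trans rs _.
Qed.

Lemma ray_classP r s : ray M s -> ray_class M r = ray_class M s -> ray_equiv r s.
Proof.
move=> rs rsE; have : ray_class M s s by split=> //; exact: ray_equiv_refl.
by rewrite -rsE => -[].
Qed.

(** From a vertex of least degree the ray cannot go down, so it climbs a matched arrow. It cannot
    climb twice in a row, because two matched arrows would share a vertex. Hence the ray alternates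
    between two degrees from then on. *)
Lemma ray_up r j : ray M r -> (forall i, (degree (r j) <= degree (r i))%N) ->
  M (r j.+1, r j) /\ hasse (r j.+1) (r j.+2).
Proof.
move=> [inj wr] minj; have up : M (r j.+1, r j).
  have /marrowP[[rr _]|//] := wr j.
  by have := minj j.+1; rewrite (degree_hasse gP fP rr) ltnn.
split=> //; have /marrowP[[]//|up'] := wr j.+1.
have /(congr1 fst)/inj/eqP : (r j.+1, r j) = (r j.+2, r j.+1).
  by apply: (matching_eq up up' (v := r j.+1)); [left | right].
by rewrite ltn_eqF.
Qed.

Lemma ray_degree_double r n j : ray M r -> ray_degree r n -> degree (r j) = n ->
  forall i, degree (r (j + i.*2)%N) = n.
Proof.
move=> rr [_ minn] jn; elim=> [|i IHi]; first by rewrite addn0.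
have [|up dn] := @ray_up r (j + i.*2) rr; first by move=> k; rewrite IHi.
rewrite doubleS !addnS; apply: succn_inj.
by rewrite -(degree_hasse gP fP dn) (degree_hasse gP fP (matching_hasse up)) IHi.
Qed.

Lemma ray_degree_late r n K : ray M r -> ray_degree r n ->
  exists2 j, (K <= j)%N & degree (r j) = n.
Proof.
move=> rr rn; have [[j jn] _] := rn; exists (j + K.*2)%N.
  by rewrite -addnn; apply: leq_trans (leq_addl _ _); apply: leq_addl.
exact: ray_degree_double.
Qed.

Lemma ray_degree_exists r : exists n, ray_degree r n.
Proof.
pose Q n := `[< exists j, degree (r j) = n >].
have exQ : exists n, Q n by exists (degree (r 0%N)); apply/asboolP; exists 0%N.
have [n /asboolP[j jn] minn] := ex_minnP exQ.
exists n; split; first by exists j.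
by move=> i; apply: minn; apply/asboolP; exists i.
Qed.

Lemma ray_degree_le r s n m : ray M s -> ray_equiv r s ->
  ray_degree r n -> ray_degree s m -> (n <= m)%N.
Proof.
move=> rs [K [N rsE]] [_ minn] sm.
have [j /subnKC Nj jm] := ray_degree_late N rs sm.
by rewrite -jm -Nj -rsE.
Qed.

Context (finR : finite_set (ray_classes M)).

(** Otherwise [r] offers branching points without end, at each of which both continuations lead back
    to [r]. The diagonal walk uses them to leave a representative of every class infinitely often;
    being itself a ray, it would belong to one of these classes. *)
Lemma no_detour r : ray M r -> exists K, forall a z b, (K <= a)%N ->
  e (r a) z -> reach z (r b) -> z = r a.+1.
Proof.
move=> rr; apply: contrapT => noK.
have [k [c cP]] : exists k (c : nat -> set (nat -> P)),
    forall C, ray_classes M C -> exists2 j, (j < k)%N & c j = C.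
  have [cs csE] := (finite_seqP _).1 finR.
  exists (size cs), (nth set0 cs) => C; rewrite csE /= => Ccs.
  by exists (index C cs); rewrite ?index_mem ?nth_index.
have /choice[rho rhoP] j : exists s : nat -> P, ray M s /\
    (ray_classes M (c j) -> ray_class M s = c j).
  by have [[s rs <-]|nc] := pselect (ray_classes M (c j)); [exists s | exists r].
have k_gt0 : (0 < k)%N.
  by have [|j jk _] := cP (ray_class M r); [exists r | apply: leq_trans jk].
pose V : set P := [set v | exists b, reach v (r b)].
(* The [k] representatives are taken cyclically, so each of them is avoided at infinitely many
   stages. *)
have [s ws sP] : exists2 s, walk e s & forall i, exists2 t, (i <= t)%N &
    forall p, rho (i %% k)%N p = s t -> rho (i %% k)%N p.+1 <> s t.+1.
  apply: (@diagonal_walk _ e V (fun i => rho (i %% k)%N) (r 0%N)).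
  - by move=> i; case: (rhoP (i %% k)%N) => -[].
  - move=> v [b vb].
    have [a [z [b' [ba az zb' za]]]] : exists a z b',
        [/\ (b <= a)%N, e (r a) z, reach z (r b') & z <> r a.+1].
      apply: contrapT => no; apply: noK; exists b => a z b' ba az zb'.
      by apply: contrapT => za; apply: no; exists a, z, b'.
    exists (r a); split; first by apply: reach_trans vb _; apply: walk_reach ba; case: rr.
    exists (r a.+1), z; split; first by move=> /esym.
      by split=> //; case: rr.
    by split; [exists a.+1; apply: reach_refl | exists b'].
  - by exists 0%N; apply: reach_refl.
have rs := walk_ray ws.
have [j jk cj] := cP (ray_class M s) (ex_intro2 _ _ s rs erefl).
have [rj rjc] := rhoP j.
have [|K [N rjs]] := @ray_classP (rho j) s rs.
  by rewrite rjc ?cj //; exists s.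
(* This stage avoids [rho j], and it occurs after index [N], where [s] already agrees with
   [rho j]. *)
have [t Nt tP] := sP (N * k + j)%N.
have tj : rho ((N * k + j) %% k)%N = rho j by rewrite modnMDl modn_small.
have {}Nt : (N <= t)%N.
  by apply: leq_trans Nt; apply: leq_trans (leq_addr _ _); apply: leq_pmulr.
have := tP (K + (t - N))%N; rewrite tj -addnS !rjs addnS subnKC //.
by move=> /(_ erefl).
Qed.

(** Decreases along arrows, hence is constant on a tail of every ray when there are finitely many
    classes. On tame rays it determines the class ([tame_limits_inj]). *)
Definition limits v : set (set (nat -> P)) :=
  [set C | exists r, [/\ ray M r, reach v (r 0%N) & ray_class M r = C]].

Lemma limits_reach v w : reach v w -> limits w `<=` limits v.
Proof.
by move=> vw C [r [rr wr rC]]; exists r; split=> //; apply: reach_trans vw wr.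
Qed.

Lemma limits_ray_classes v : limits v `<=` ray_classes M.
Proof. by move=> C [r [rr _ <-]]; exists r. Qed.

(** Normal form for the ray to be reversed: [tame_up] places the matched arrows at even indices,
    [tame_detour] prevents the reversal from creating cycles, and [tame_limits] keeps the rays of
    distinct classes disjoint. *)
Record tame C (r : nat -> P) : Prop := Tame {
  tame_ray : ray M r;
  tame_class : ray_class M r = C;
  tame_up : forall i, M (r i.*2.+1, r i.*2);
  tame_degree : ray_degree r (degree (r 0%N));
  tame_detour : forall a z b, e (r a) z -> reach z (r b) -> z = r a.+1;
  tame_limits : forall a, limits (r a) = limits (r 0%N) }.

Lemma tame_exists C : ray_classes M C -> exists r, tame C r.
Proof.
move=> [r rr rC]; have [n rn] := ray_degree_exists r.
have [K1 K1P] := no_detour rr.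
have [K2 K2P] : exists K, forall a, (K <= a)%N -> limits (r a) = limits (r K).
  apply: (@antitone_stabilizes _ (fun a => limits (r a))) => [a|].
    by apply: limits_reach; apply: reach1; case: rr.
  by apply: sub_finite_set finR; apply: limits_ray_classes.
have [j Kj jn] := ray_degree_late (maxn K1 K2) rr rn.
have [K1j K2j] : (K1 <= j)%N /\ (K2 <= j)%N by move: Kj; rewrite geq_max => /andP.
exists (tail j r); split.
- exact: tail_ray.
- by rewrite -rC; apply/esym/ray_class_eq/tail_equiv.
- move=> i; rewrite /tail addnS.
  have [|//] := @ray_up r (j + i.*2) rr.
  by move=> k; rewrite (ray_degree_double rr rn jn); case: rn.
- rewrite /tail addn0 jn; split; first by exists 0%N; rewrite addn0.
  by move=> i; case: rn.
- move=> a z b; rewrite /tail addnS; apply: K1P.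
  by apply: leq_trans K1j (leq_addr _ _).
- by move=> a; rewrite /tail !K2P // (leq_trans K2j) ?leq_addr.
Qed.

End Rays.

(** * Reversing the matching along tame rays *)

Section Reversal.
Context {d : Order.disp_t} {P : porderType d}.
Context (M : set (P * P)) (morseM : morse_matching M).
Context (finR : finite_set (ray_classes M)).
Context (rho : set (nat -> P) -> nat -> P).
Context (rhoP : forall C, ray_classes M C -> tame M C (rho C)).
Implicit Types (v w x y z : P) (r s : nat -> P) (C : set (nat -> P)).
Local Notation e := (marrow M).
Local Notation reach := (reach (marrow M)).
Local Notation RC := (ray_classes M).

Let rho_inj C : RC C -> injective (rho C).
Proof. by move=> /rhoP/tame_ray[]. Qed.

Let rho_arrow C i : RC C -> e (rho C i) (rho C i.+1).
Proof. by move=> /rhoP/tame_ray[]. Qed.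



Lemma tame_between C a w b : RC C -> reach (rho C a) w -> reach w (rho C b) ->
  exists2 c, (a <= c)%N & w = rho C c.
Proof.
move=> RCC [p + pw] wb; elim: p a pw => [|z p IHp] a /= pw.
  by exists a.
case/andP=> az zp; have za : z = rho C a.+1.
  apply: (tame_detour (rhoP RCC) az (b := b)).
  by apply: reach_trans wb; exists p.
by rewrite za in pw zp; have [c ac wc] := IHp _ pw zp; exists c => //; apply: ltnW.
Qed.

Lemma limits_reach_tame C v : RC C -> limits M v C ->
  exists N, reach v (rho C N).
Proof.
move=> RCC [r [rr vr rC]]; have tC := rhoP RCC.
have [|K [N rE]] := @ray_classP _ _ M r (rho C) (tame_ray tC).
  by rewrite rC (tame_class tC).
exists N; have := rE 0%N; rewrite !addn0 => <-; apply: reach_trans vr _.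
by apply: walk_reach => //; case: rr.
Qed.

Lemma tame_limits_self C a : RC C -> limits M (rho C a) C.
Proof.
move=> RCC; rewrite (tame_limits (rhoP RCC)).
exists (rho C); split; [exact: tame_ray (rhoP RCC) | exact: reach_refl | ].
exact: tame_class (rhoP RCC).
Qed.

(** Equal limits give a path from [rho C] to some [rho C' N], and paths from every vertex of
    [rho C'] back to [rho C]. Without detours [rho C' N] lies on [rho C], and each further step of
    [rho C'] is the step of [rho C]. *)
Lemma tame_limits_inj C C' : RC C -> RC C' ->
  limits M (rho C 0%N) = limits M (rho C' 0%N) -> C = C'.
Proof.
move=> RCC RCC' CC'; have tC := rhoP RCC; have tC' := rhoP RCC'.
have toC v : limits M v = limits M (rho C 0%N) -> exists b, reach v (rho C b).
  by move=> vE; apply: limits_reach_tame => //; rewrite vE; apply: tame_limits_self.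
have [N rN] : exists N, reach (rho C 0%N) (rho C' N).
  by apply: limits_reach_tame => //; rewrite CC'; apply: tame_limits_self.
have C'C a : exists b, reach (rho C' a) (rho C b).
  by apply: toC; rewrite (tame_limits tC') CC'.
have [b Nb] := C'C N; have [c _ Nc] := tame_between RCC rN Nb.
rewrite -(tame_class tC) -(tame_class tC'); apply: ray_class_eq.
exists c, N => i; elim: i => [|i IHi]; first by rewrite !addn0.
have [b' ib'] := C'C (N + i.+1)%N.
rewrite [in LHS]addnS; apply/esym; apply: (tame_detour tC) ib'.
by rewrite IHi addnS; apply: rho_arrow.
Qed.

Lemma tame_disjoint C C' a a' : RC C -> RC C' -> rho C a = rho C' a' ->
  C = C' /\ a = a'.
Proof.
move=> RCC RCC' aa'; have CC' : C = C'.
  apply: tame_limits_inj => //.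
  by rewrite -(tame_limits (rhoP RCC) a) aa' (tame_limits (rhoP RCC')).
by split=> //; move: aa'; rewrite -CC' => /(rho_inj RCC).
Qed.

(** Along a ray the step from [2i] to [2i+1] climbs a matched arrow and the step from [2i+1] to
    [2i+2] descends an unmatched one. The matching trades the former ([ray_edge]) for the latter
    ([shifted_edge]), which frees only the origin. *)
Definition ray_edge (f : P * P) : Prop :=
  exists C i, RC C /\ f = (rho C i.*2.+1, rho C i.*2).

Definition shifted_edge (f : P * P) : Prop :=
  exists C i, RC C /\ f = (rho C i.*2.+1, rho C i.*2.+2).

Definition reversal : set (P * P) :=
  [set f | (M f /\ ~ ray_edge f) \/ shifted_edge f].



Lemma matched_ray_edge f C a : RC C -> M f ->
  rho C a = f.1 \/ rho C a = f.2 -> ray_edge f.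
Proof.
move=> RCC Mf af; exists C, a./2; split=> //.
apply: (matching_eq morseM Mf (tame_up (rhoP RCC) _) af) => /=.
by rewrite -[a in rho C a]odd_double_half; case: (odd a); [left | right].
Qed.

Lemma shifted_edge_hasse x y : shifted_edge (x, y) -> hasse x y.
Proof.
move=> [C [i [RCC [-> ->]]]].
have /marrowP[[]//|M2] := rho_arrow i.*2.+1 RCC.
have [C' [j [RCC' [e1 e2]]]] : ray_edge (rho C i.*2.+2, rho C i.*2.+1).
  by apply: (matched_ray_edge RCC M2); left.
have [_ j1] := tame_disjoint RCC RCC' e1; have [_ j2] := tame_disjoint RCC RCC' e2.
by move: j1; rewrite -doubleS => /(congr1 odd); rewrite /= !odd_double.
Qed.

Lemma reversal_hasse x y : reversal (x, y) -> hasse x y.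
Proof. by case=> [[/(matching_hasse morseM)]|/shifted_edge_hasse]. Qed.

Lemma reversal_matching : matching reversal.
Proof.
split; first exact: reversal_hasse.
have mixed f g v : M f -> ~ ray_edge f -> shifted_edge g ->
    v = f.1 \/ v = f.2 -> v = g.1 \/ v = g.2 -> f = g.
  move=> Mf nf [C [i [RCC ->]]] vf /= vg; exfalso; apply: nf.
  by case: vg => vE; rewrite vE in vf; apply: matched_ray_edge vf.
move=> f g v [[Mf nf]|sf] [[Mg ng]|sg] vf vg.
- exact: (matching_eq morseM Mf Mg vf vg).
- exact: (mixed f g v).
- exact/esym/(mixed g f v).
move: sf sg => [C [i [RCC fE]]] [C' [i' [RCC' gE]]]; rewrite fE gE /= in vf vg *.
suff [CC' ii'] : C = C' /\ i.*2 = i'.*2 by rewrite CC' ii'.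
case: vf => ->{v} in vg *; case: vg => /(tame_disjoint RCC RCC')[-> /eqP].
- by rewrite eqSS => /eqP.
- by rewrite -!doubleS => /eqP/(congr1 odd); rewrite /= !odd_double.
- by rewrite -!doubleS => /eqP/(congr1 odd); rewrite /= !odd_double.
- by rewrite !eqSS => /eqP.
Qed.

Lemma tame_start_matched C : RC C -> ~ critical M (rho C 0%N).
Proof. by move=> RCC /(_ _ (tame_up (rhoP RCC) 0%N))[_]. Qed.

Lemma reversal_critical x :
  critical reversal x <-> critical M x \/ exists2 C, RC C & rho C 0%N = x.
Proof.
split=> [xc|[xc|[C RCC <-]] f].
- have [?|xM] := pselect (critical M x); [by left | right].
  have [f [Mf xf]] : exists f, M f /\ (x = f.1 \/ x = f.2).
    apply: contrapT => nof; apply: xM => f Mf.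
    by split=> xf; apply: nof; exists f; split=> //; [left | right].
  have [[C [i [RCC fE]]]|nf] := pselect (ray_edge f); last first.
    by have [] := xc f (or_introl (conj Mf nf)); case: xf.
  exists C => //; case: xf => xf; rewrite xf fE /=.
    have : reversal (rho C i.*2.+1, rho C i.*2.+2) by right; exists C, i.
    by move=> /xc[]; rewrite xf fE.
  case: i fE => // i fE.
  have : reversal (rho C i.*2.+1, rho C i.*2.+2) by right; exists C, i.
  by move=> /xc[_]; rewrite xf fE.
- move=> [[/xc//]|[C [i [RCC ->]]]] /=; have tC := rhoP RCC.
  have [x1 _] := xc _ (tame_up tC i); have [_ x2] := xc _ (tame_up tC i.+1).
  by split.
- move=> [[Mf nf]|[C' [i [RCC' ->]]]] /=.
    by split=> xf; apply: nf; apply: (matched_ray_edge RCC Mf (a := 0%N)); auto.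
  by split=> /(tame_disjoint RCC RCC')[].
Qed.

Lemma reversal_arrow v w : marrow reversal v w ->
  (e v w /\ ~ exists C a, [/\ RC C, v = rho C a & w = rho C a.+1]) \/
  exists C a, [/\ RC C, v = rho C a.+1 & w = rho C a].
Proof.
move=> /marrowP[[vw nM']|[[Mwv nwv]|[C [i [RCC [-> ->]]]]]]; last 2 first.
- left; split; first by apply/marrowP; right.
  move=> [C [a [RCC va wa]]]; apply: nwv.
  by apply: (matched_ray_edge RCC Mwv (a := a)); right.
- by right; exists C, i.*2.+1.
have [Mvw|nMvw] := pselect (M (v, w)).
  have [[C [i [RCC [-> ->]]]]|nvw] := pselect (ray_edge (v, w)).
    by right; exists C, i.*2.
  by case: nM'; left.
left; split; first by apply/marrowP; left.
move=> [C [a [RCC va wa]]]; have [i] : exists i, a = i.*2 \/ a = i.*2.+1.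
  by exists a./2; rewrite -{1 3}[a]odd_double_half; case: (odd a); auto.
move=> [] ai; rewrite ai in va wa.
  have := matching_hasse morseM (tame_up (rhoP RCC) i); rewrite -va -wa => -[vw' _].
  by case: vw => wv _; have := lt_trans vw' wv; rewrite ltxx.
by apply: nM'; right; exists C, i; rewrite va wa.
Qed.

(** Along the walk [limits] decreases, as reversed ray arrows leave it unchanged; it is eventually
    constant. Reversed arrows occur infinitely often, for otherwise a tail would be a ray of [M],
    finally coinciding with the representative of its class, whose arrows are no longer available.
    Late reversed arrows all belong to one ray, and between two of them a path of old arrows would
    be a detour; so the walk runs down that ray towards its origin, which cannot go on forever. *)
Lemma reversal_no_walk s : ~ walk (marrow reversal) s.
Proof.
move=> ws.
have lim_s i : limits M (s i.+1) `<=` limits M (s i).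
  have [[si _]|[C [a [RCC -> ->]]]] := reversal_arrow (ws i).
    exact: limits_reach (reach1 si).
  by rewrite !(tame_limits (rhoP RCC)).
have [K KP] : exists K, forall n, (K <= n)%N -> limits M (s n) = limits M (s K).
  apply: antitone_stabilizes => //; apply: sub_finite_set finR.
  exact: limits_ray_classes.
pose back t := exists C a, [/\ RC C, s t = rho C a.+1 & s t.+1 = rho C a].
have forth t : ~ back t ->
    e (s t) (s t.+1) /\ ~ exists C a, [/\ RC C, s t = rho C a & s t.+1 = rho C a.+1].
  by case: (reversal_arrow (ws t)).
have often t0 : exists2 t, (t0 <= t)%N & back t.
  apply: contrapT => noback; pose r := tail t0 s.
  have fr i : ~ back (t0 + i)%N.
    by move=> bi; apply: noback; exists (t0 + i)%N => //; apply: leq_addr.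
  have rr : ray M r.
    by apply: walk_ray => // i; rewrite /r /tail addnS; case: (forth _ (fr i)).
  have RCr : RC (ray_class M r) by exists r.
  have [|K' [N rE]] := @ray_classP _ _ M r (rho (ray_class M r)) (tame_ray (rhoP RCr)).
    by rewrite (tame_class (rhoP RCr)).
  have [_ []] := forth _ (fr K'); exists (ray_class M r), N; split=> //.
    by have := rE 0%N; rewrite !addn0.
  by have := rE 1%N; rewrite !addn1 /r /tail addnS.
have next_back t : exists t', [/\ (t <= t')%N, back t' &
    forall i, (t <= i < t')%N -> ~ back i].
  pose Q k := `[< (t <= k)%N /\ back k >].
  have exQ : exists k, Q k.
    by have [k tk bk] := often t; exists k; apply/asboolP.
  have [t' /asboolP[tt' bt'] mint'] := ex_minnP exQ.
  exists t'; split=> // i /andP[ti it'] bi.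
  by have : Q i; [exact/asboolP | move/mint'; rewrite leqNgt it'].
have [t0 Kt0 [C [a0 [RCC st0 _]]]] := often K.
suff down k : exists a, s (t0 + k)%N = rho C a /\ (a + k)%N = a0.+1.
  (* Starting from index [a0.+1], there is no room for [a0.+2] steps down. *)
  have [a [_]] := down a0.+2; lia.
elim: k => [|k [a [sa ak]]]; first by exists a0.+1; rewrite !addn0.
have [t' [tt' [C' [a' [RCC' st' st'1]]] nback]] := next_back (t0 + k)%N.
have CC' : C' = C.
  apply: tame_limits_inj => //.
  rewrite -(tame_limits (rhoP RCC') a'.+1) -st' -(tame_limits (rhoP RCC) a) -sa.
  by rewrite !KP //; move: tt' Kt0; lia.
rewrite {}CC' in RCC' st' st'1.
have [t't|t'nt] := eqVneq t' (t0 + k)%N.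
  rewrite t't in st' st'1; exists a'; rewrite addnS; split=> //.
  by move: st'; rewrite sa => /(rho_inj RCC); lia.
have {}tt' : (t0 + k < t')%N by rewrite ltn_neqAle eq_sym t'nt.
(* The walk leaves [rho C a] by an old arrow and returns to the ray at [s t']; by [tame_detour] that
   arrow is the forward ray arrow, which has been reversed. *)
exfalso; have [|sk []] := forth (t0 + k)%N.
  by apply: nback; rewrite leqnn.
exists C, a; split=> //.
rewrite sa in sk; apply: (tame_detour (rhoP RCC) sk (b := a'.+1)).
rewrite -st' -(subnKC tt').
have : forall j, ((t0 + k).+1 + j <= t')%N -> reach (s (t0 + k).+1) (s ((t0 + k).+1 + j)%N).
  elim=> [|j IHj] jt'; first by rewrite addn0; apply: reach_refl.
  apply: reach_trans (IHj _) _; first by move: jt'; lia.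
  rewrite addnS; apply: reach1; case: (forth ((t0 + k).+1 + j)%N) => //.
  by apply: nback; move: jt'; lia.
by apply; rewrite subnKC.
Qed.

End Reversal.

Lemma well_founded_min (T : Type) (R : T -> T -> Prop) (Q : T -> Prop) :
  well_founded R -> (exists v, Q v) ->
  exists2 v, Q v & forall w, R w v -> ~ Q w.
Proof.
move=> wfR [v Qv]; elim/(well_founded_ind wfR): v Qv => v IHv Qv.
have [[w wv Qw]|now] := pselect (exists2 w, R w v & Q w); first exact: IHv Qw.
by exists v => // w wv Qw; apply: now; exists w.
Qed.

Lemma well_founded_reach (T : Type) (e : rel T) :
  well_founded (fun w v => e v w) ->
  well_founded (fun w v => exists2 u, e v u & reach e u w).
Proof.
move=> wfe; suff acc v w : reach e v w ->
    Acc (fun w v => exists2 u, e v u & reach e u w) w.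
  by move=> v; apply: acc (reach_refl e v).
elim/(well_founded_ind wfe): v w => v IHv w [[|u p] /= + <-].
  by move=> _; split=> w' [u vu uw']; apply: IHv uw'.
by case/andP=> vu up; apply: (IHv _ vu); exists p.
Qed.

(** * Filtration of [P] by closed subsets *)

Section Closure.
Context {d : Order.disp_t} {P : porderType d}.
Context (gP : graded P) (fP : finite_principal_ideals P).
Context (acP : forall x y : P, hasse x y -> acyclic (sdown x `\ y)).
Context (M : set (P * P)) (matchM : matching M).
Context (wfM : well_founded (fun y x => marrow M x y)).
Implicit Types (A F : set P) (v w x y z : P).

Let M_hasse x y : M (x, y) -> hasse x y. Proof. exact: matchM.1. Qed.

Let M_irr x : ~ M (x, x).
Proof. by move=> /M_hasse[]; rewrite ltxx. Qed.

Let M_eq a b v : M a -> M b ->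
  (v = a.1 \/ v = a.2) -> (v = b.1 \/ v = b.2) -> a = b.
Proof. exact: matchM.2. Qed.

Definition top v := xget v [set x | M (x, v)].

Lemma topP v : (M (top v, v)) \/ (top v = v /\ forall x, ~ M (x, v)).
Proof. by rewrite /top; case: xgetP => [x _ Mx|nox]; [left | right]. Qed.

Lemma top_eq x v : M (x, v) -> top v = x.
Proof.
have [Mt Mx|[_ nov] /nov//] := topP v.
by have [] : (top v, v) = (x, v) by apply: (M_eq Mt Mx (v := v)); right.
Qed.

Lemma M_top x v : ~ M (x, top v).
Proof.
have [Mt Mx|[-> //]] := topP v.
have [_ tv] : (x, top v) = (top v, v).
  by apply: (M_eq Mx Mt (v := top v)); [right | left].
by apply: (M_irr (x := v)); rewrite -{1}tv.
Qed.

(* The part of [v] in the partition of [P] into matched pairs and critical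
   singletons; [top v] is its largest element. *)
Definition block v : set P := [set w | w = top v \/ M (top v, w)].

Lemma block_refl v : block v v.
Proof. by have [Mt|[tv _]] := topP v; [right | left]. Qed.

Lemma block_matched v x y : M (x, y) -> (block v x <-> block v y).
Proof.
move=> Mxy; split=> -[].
- by move=> xt; right; rewrite -xt.
- move=> Mtx; exfalso; have [_ xy] : (top v, x) = (x, y).
    by apply: (M_eq Mtx Mxy (v := x)); [right | left].
  by apply: (M_irr (x := y)); rewrite -{1}xy.
- by move=> yt; exfalso; apply: (M_top (x := x) (v := v)); rewrite -yt.
- move=> Mty; left; have [] // : (x, y) = (top v, y).
  by apply: (M_eq Mxy Mty (v := y)); right.
Qed.

Lemma block_le_top v w : block v w -> (w <= top v)%O.
Proof. by case=> [->//|/M_hasse[/ltW]]. Qed.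

(** Says that [z] must be present before the part of [v] can be added to a down-set. *)
Definition precedes z v := exists v', [/\ block v v', hasse v' z & ~ block v z].

Lemma reach_top v : reach (marrow M) v (top v).
Proof.
have [Mt|[-> _]] := topP v; last exact: reach_refl.
by apply: reach1; apply/asboolP; right.
Qed.

Lemma precedes_wf : well_founded precedes.
Proof.
suff step z v : precedes z v ->
    exists2 u, marrow M (top v) u & reach (marrow M) u (top z).
  move=> v; have := well_founded_reach wfM (top v).
  move tv : (top v) => t acct; elim: acct v tv => {}t _ IHt v tv.
  by split=> z /step; rewrite tv => zv; apply: (IHt (top z)).
move=> [v' [[->|Mv'] v'z nz]].
  exists z; last exact: reach_top.
  by apply/asboolP; left; split=> // Mz; apply: nz; right.
have tv' := M_hasse Mv'.
have [w [zw wt wv']] := diamond gP fP acP tv' v'z.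
have dt := degree_hasse gP fP tv'; have dv' := degree_hasse gP fP v'z.
have := degree_lt gP fP zw; have := degree_lt gP fP wt => lt1 lt2.
have tw : hasse (top v) w by apply: (hasse_degree gP fP) => //; lia.
have wz : hasse w z by apply: (hasse_degree gP fP) => //; lia.
exists w.
  apply/asboolP; left; split=> // Mw; apply: wv'.
  by have [] : (top v, w) = (top v, v') by apply: (M_eq Mw Mv' (v := top v)); left.
have [Mwz|nMwz] := pselect (M (w, z)); first by rewrite (top_eq Mwz); apply: reach_refl.
by apply: reach_trans (reach_top z); apply: reach1; apply/asboolP; left.
Qed.

Definition mclosed A := dclosed A /\ forall x y, M (x, y) -> (A x <-> A y).

Lemma closed_block A v : mclosed A -> A v -> block v `<=` A.
Proof.
move=> [_ mA] Av w [->|/mA[tw _]]; last apply: tw.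
  by have [/mA[_]|[->]] := topP v; auto.
by have [/mA[_]|[->]] := topP v; auto.
Qed.

Lemma closedU_block A v : mclosed A -> (forall z, precedes z v -> A z) ->
  mclosed (A `|` block v).
Proof.
move=> [dA mA] vA; split=> [a b Aa|x y Mxy]; last first.
  have [xy yx] := block_matched v Mxy; have [xy' yx'] := mA _ _ Mxy.
  by split=> -[]; [left | right | left | right]; auto.
have [n an] := ubnP (degree a); elim: n a an Aa => // n IHn a an Aa.
rewrite le_eqVlt => /predU1P[-> //|/(lt_hasse gP fP)[w aw bw]].
case: Aa => [Aa|av].
  by have [/ltW wa _] := aw; left; apply: (dA w b _ bw); apply: (dA a w).
have [wv|wv] := pselect (block v w).
  by apply: (IHn w) => //; [move: an; rewrite (degree_hasse gP fP aw) | right].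
by left; apply: (dA w b _ bw); apply: vA; exists a.
Qed.

Lemma closed_bigcup (I : Type) (D : set I) (F : I -> set P) :
  (forall i, D i -> mclosed (F i)) -> mclosed (\bigcup_(i in D) F i).
Proof.
move=> cF; split=> [a b [i Di Fa] ba|x y Mxy].
  by exists i => //; apply: (cF _ Di).1 Fa ba.
by split=> -[i Di Fi]; exists i => //; apply/((cF _ Di).2 _ _ Mxy).
Qed.

(** Only finitely many elements precede [v]; their finite closures, which exist by induction,
    together with the part of [v] form a closed set. *)
Lemma closure1 v : exists F, [/\ finite_set F, mclosed F & F v].
Proof.
elim/(well_founded_ind precedes_wf): v => v IHv.
have /choice[G GP] z : exists G, precedes z v -> [/\ finite_set G, mclosed G & G z].
  by have [/IHv[G ?]|nz] := pselect (precedes z v); [exists G | exists set0].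
exists ((\bigcup_(z in [set z | precedes z v]) G z) `|` block v); split; last by right; apply: block_refl.
  rewrite finite_setU; split.
    apply: bigcup_finite => [|z /GP[]//].
    apply: sub_finite_set (fP (top v)) => z [v' [/block_le_top v't [zv' _] _]].
    exact: le_trans (ltW zv') v't.
  by apply: sub_finite_set (fP (top v)) => w /block_le_top.
apply: closedU_block; first by apply: closed_bigcup => z /GP[].
by move=> z zv; exists z => //; case: (GP z zv).
Qed.

Lemma closure_finite A : finite_set A -> exists F, [/\ finite_set F, mclosed F & A `<=` F].
Proof.
move=> fA; have [G GP] := choice closure1.
exists (\bigcup_(z in A) G z); split; last by move=> z Az; exists z => //; case: (GP z).
  by apply: bigcup_finite => // z _; case: (GP z).
by apply: closed_bigcup => z _; case: (GP z).
Qed.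

(** The part to add next is that of a [precedes]-minimal [v] in [F] outside [A], so that all
    elements under it are already in [A]. The induction is on the number of missing elements. *)
Lemma closed_ind F0 F (Q : set P -> Prop) : finite_set F -> mclosed F0 -> mclosed F ->
  F0 `<=` F -> Q F0 ->
  (forall A x, F0 `<=` A -> mclosed A -> dclosed (A `|` [set x]) -> ~ A x -> F x ->
     critical M x -> Q A -> Q (A `|` [set x])) ->
  (forall A x y, F0 `<=` A -> mclosed A -> dclosed (A `|` [set y] `|` [set x]) ->
     ~ A x -> ~ A y -> M (x, y) -> Q A -> Q (A `|` [set y] `|` [set x])) ->
  Q F.
Proof.
move=> fF cF0 cF F0F QF0 Qcrit Qpair.
suff ind n A : mclosed A -> F0 `<=` A -> A `<=` F ->
    (#|` fset_set (F `\` A)| <= n)%N -> Q A -> Q F.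
  exact: (ind _ F0).
elim: n A => [|n IHn] A cA F0A AF.
  rewrite leqn0 cardfs_eq0 => /eqP FA; suff -> : A = F by [].
  apply/seteqP; split=> // v Fv; apply: contrapT => Av.
  have : v \in fset_set (F `\` A).
    by rewrite in_fset_set ?inE //; apply: finite_setD.
  by rewrite FA inE.
move=> FAn QA; have [FA|nFA] := pselect (F `<=` A).
  by suff -> : F = A by []; apply/seteqP.
have [v [Fv Av] minv] : exists2 v, F v /\ ~ A v &
    forall w, precedes w v -> ~ (F w /\ ~ A w).
  apply: well_founded_min precedes_wf _; apply: contrapT => nov; apply: nFA => v Fv.
  by apply: contrapT => Av; apply: nov; exists v.
have vF := closed_block cF Fv.
have precA z : precedes z v -> A z.
  move=> zv; apply: contrapT => Az; apply: (minv z zv); split=> //.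
  have [v' [/vF Fv' [zv' _] _]] := zv.
  exact: cF.1 Fv' (ltW zv').
have cAv := closedU_block cA precA.
have vA w : block v w -> ~ A w.
  move=> vw Aw; apply: Av; move: vw Aw => [->|Mw] Aw.
    by have [/(cA.2)[+ _]|[<- //]] := topP v; apply.
  have : block w v; last exact: closed_block cA Aw v.
  by rewrite /block /= (top_eq Mw); exact: block_refl.
suff : Q (A `|` block v).
  apply: IHn => //; first by apply: subset_trans F0A _; left.
    by move=> w [/AF|/vF].
  rewrite -ltnS; apply: leq_trans FAn; apply: fproper_ltn_card.
  have finD B : finite_set (F `\` B) by exact: finite_setD.
  apply/andP; split.
    by rewrite -fset_set_sub // => w [Fw nw]; split=> // Aw; apply: nw; left.
  apply/negP; rewrite -fset_set_sub // => /(_ v (conj Fv Av))[_]; apply.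
  by right; apply: block_refl.
have [[y My]|noy] := pselect (exists y, M (top v, y)).
  have blockE : A `|` block v = A `|` [set y] `|` [set top v].
    rewrite -setUA; congr (_ `|` _); apply/seteqP; split=> w.
      move=> [->|Mw]; [by right | left].
      by have [] : (top v, w) = (top v, y) by apply: (M_eq Mw My (v := top v)); left.
    by move=> [->|->]; [right | left].
  rewrite blockE; apply: Qpair => //; first by rewrite -blockE; case: cAv.
    by apply: vA; left.
  by apply: vA; right.
have vt : top v = v by have [Mt|[]//] := topP v; case: noy; exists v.
have blockE : block v = [set v].
  apply/seteqP; split=> w; last by move=> ->; apply: block_refl.
  by move=> [->//|Mw]; case: noy; exists w.
rewrite blockE; apply: Qcrit => //; first by rewrite -blockE; case: cAv.
move=> [x y] Mxy /=; split=> vE.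
  by apply: noy; exists y; rewrite vt vE.
by have [Mt|[_ /(_ x)[]]] := topP v; [apply: noy; exists v | rewrite vE].
Qed.

End Closure.

(** * Counting critical elements of finite closed subsets *)

Section Core.
Context {d : Order.disp_t} {P : porderType d}.
Context (gP : graded P) (fP : finite_principal_ideals P).
Context (acP : forall x y : P, hasse x y -> acyclic (sdown x `\ y)).
Context (M : set (P * P)) (matchM : matching M).
Context (wfM : well_founded (fun y x => marrow M x y)).
Implicit Types (A F : set P) (x y z : P) (u : {freeg seq P}).

Definition criticals n : set P := [set x | critical M x /\ degree x = n].
Definition ncritical n A : nat := #|` fset_set (A `&` criticals n)|.

Lemma hrank_set0 n : hrank n (set0 : set P) 0.
Proof.
split; first by exists (fun=> 0); split=> [[]|c _ []].
move=> v [v0 indv]; have /(indv (fun=> 1))/(_ ord0) // : bnd n set0 (\sum_i v i *~ 1).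
by rewrite big_ord1 mulr1z (chainsn_set0 (v0 ord0).1); apply: (bnd_subgroup _ _).1.
Qed.

Definition morse_count A := exists beta e : nat -> nat,
  [/\ forall n, hrank n A (beta n), e 0%N = 0%N &
      forall n, ncritical n A = beta n + e n + e n.+1]%N.

Lemma not_critical_pair x y : M (x, y) -> ~ critical M x /\ ~ critical M y.
Proof. by move=> Mxy; split=> /(_ _ Mxy)[]. Qed.

Lemma countU_not n A x : ~ critical M x -> ncritical n (A `|` [set x]) = ncritical n A.
Proof.
move=> nx; rewrite /ncritical; congr (#|` fset_set _|); apply/seteqP; split=> z.
  by move=> [[Az|-> [/nx]//]].
by move=> [Az zn]; split=> //; left.
Qed.

Lemma countU n A x : finite_set A -> ~ A x -> critical M x ->
  ncritical n (A `|` [set x]) = (ncritical n A + (n == degree x))%N.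
Proof.
move=> fA Ax cx; rewrite /ncritical; have [->|nx] := eqVneq n (degree x).
  have -> : (A `|` [set x]) `&` criticals (degree x) = (A `&` criticals (degree x)) `|` [set x].
    by rewrite setIUl; congr (_ `|` _); apply/seteqP; split=> [z []//|z ->].
  rewrite fset_setU //; last exact: finite_setIl.
  rewrite fset_set1 fsetUC cardfsU1 in_fset_set; last exact: finite_setIl.
  by rewrite addn1; case: (boolP (x \in _)) => //; rewrite inE => -[].
rewrite addn0; congr (#|` fset_set _|); apply/seteqP; split=> z.
  by move=> [[Az|->]]// [_ xn]; rewrite xn eqxx in nx.
by move=> [Az zn]; split=> //; left.
Qed.

Lemma pair_rel n A x y : mclosed M A -> dclosed (A `|` [set y] `|` [set x]) ->
  ~ A x -> ~ A y -> M (x, y) -> rel_acyclic n A (A `|` [set y] `|` [set x]).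
Proof.
move=> [dA _] dAyx Ax Ay Mxy; have xy := matchM.1 _ _ Mxy.
exact: pair_rel_acyclic xy (acP xy) dA Ax Ay dAyx.
Qed.

Lemma closed_set0 : mclosed M set0. Proof. by split=> // x y. Qed.

Lemma morse_count_finite F : finite_set F -> mclosed M F -> morse_count F.
Proof.
move=> fF cF.
have : finite_set F /\ morse_count F; last by case.
apply: (closed_ind gP fP acP matchM wfM
  (Q := fun A => finite_set A /\ morse_count A) fF closed_set0 cF) => //.
- split; first exact: finite_set0.
  exists (fun=> 0%N), (fun=> 0%N); split=> // n; first exact: hrank_set0.
  by rewrite /ncritical set0I fset_set0 cardfs0.
- move=> A x _ [dA _] dAx Ax _ cx [fA [beta [e [hA e0 cE]]]].
  split; first by rewrite finite_setU.
  have [s xs] := flag_exists gP fP x.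
  have [beta' hA' bb'] := attach_critical gP fP acP dA dAx Ax xs hA.
  case: bb' => [bb'|[k xk bb']].
    by exists beta', e; split=> // n; rewrite countU // bb' cE; lia.
  (* A step of the second kind, counted by [e] at the degree [k.+1] of [x]; the term [e n.+1]
     accounts for the class lost in degree [k]. *)
  exists beta', (fun n => e n + (n == degree x))%N; split=> //.
    by rewrite e0 xk.
  by move=> n; rewrite countU // cE bb' xk eqSS; lia.
- move=> A x y _ cA dAyx Ax Ay Mxy [fA [beta [e [hA e0 cE]]]].
  split; first by rewrite !finite_setU.
  exists beta, e; split=> // n; last first.
    by have [nx ny] := not_critical_pair Mxy; rewrite !countU_not.
  by apply: hrank_rel_acyclic (hA n) => [z Az||]; [left; left | exact: pair_rel | exact: pair_rel].
Qed.

(** Between [F0] and [F] only pairs and critical elements of degrees other than [k] are added, and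
    none of these contributes to relative homology in degree [k]. *)
Lemma closed_rel_acyclic k F0 F : finite_set F -> mclosed M F0 -> mclosed M F ->
  F0 `<=` F -> (F `&` criticals k `<=` F0) -> rel_acyclic k F0 F.
Proof.
move=> fF cF0 cF F0F kF0.
apply: (closed_ind gP fP acP matchM wfM (Q := rel_acyclic k F0) fF cF0 cF) => //.
- exact: rel_acyclic_refl.
- move=> A x F0A [dA _] dAx Ax Fx cx accA.
  have [s xs] := flag_exists gP fP x.
  apply: (rel_acyclic_trans F0A _ accA); first by left.
  apply: (critical_rel_acyclic gP fP acP dA dAx Ax xs).
  by apply/eqP => kx; apply: Ax; apply/F0A/kF0.
- move=> A x y F0A cA dAyx Ax Ay Mxy accA.
  apply: (rel_acyclic_trans F0A _ accA); first by move=> z; left; left.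
  exact: pair_rel.
Qed.

Lemma finite_chain_support n u : chainsn n setT u ->
  exists A, finite_set A /\ chainsn n A u.
Proof.
move=> un; exists [set` flatten (dom u)]; split; first exact: finite_seq.
move=> s us; have [[ss _] sn] := un s us; split=> //; split=> // x xs.
by apply/flattenP; exists s; rewrite ?mem_dom.
Qed.

Lemma rel_acyclic_setT k F : mclosed M F -> finite_set F -> criticals k `<=` F ->
  rel_acyclic k F setT.
Proof.
move=> cF fF kF u /finite_chain_support[A [fA Au]] Fu.
have fAF : finite_set (A `|` F) by rewrite finite_setU.
have [G [fG cG AFG]] := closure_finite gP fP acP matchM wfM fAF.
have [|||w Gw Fw] := @closed_rel_acyclic k F G fG cF cG _ _ u _ Fu.
- by move=> z Fz; apply: AFG; right.
- by move=> z [_ /kF].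
- by apply: chainsnS Au => z Az; apply: AFG; left.
by exists w => //; apply: chainsnS Gw.
Qed.

Lemma hrank_setT k F r : mclosed M F -> finite_set F ->
  criticals k `<=` F -> criticals k.+1 `<=` F -> hrank k F r -> hrank k [set: P] r.
Proof. by move=> cF fF kF kF1; apply: hrank_rel_acyclic => //; exact: rel_acyclic_setT. Qed.

(** Here [H_k(F) -> H_k(P)] is onto. Elements of degree [k.+1] outside [F] may still kill classes of
    [F], whence a bound and no equality. *)
Lemma indep_setT_bound k F r j (v : 'I_j -> {freeg seq P}) :
  mclosed M F -> finite_set F -> criticals k `<=` F -> hrank k F r ->
  indep (cyc k [set: P]) (bnd k [set: P]) v -> (j <= r)%N.
Proof.
move=> cF fF kF hF [vT indv].
have /choice[w wP] i : exists w : {freeg seq P},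
    chainsn k.+2 setT w /\ chains F (v i + bd w).
  have [vi v0] := vT i.
  by have [|w] := rel_acyclic_setT cF fF kF vi; [exact: chains_sub v0 | exists w].
apply: (has_rank_ge (v := fun i => v i + bd (w i)) hF); split=> [i|c Fc i].
  have [vi v0] := vT i; have [wi Fi] := wP i; split.
    apply: chainsn_chainsI Fi; apply: (subgroupD (chainsn_subgroup _ setT)) => //.
    exact: chainsn_bd.
  by rewrite raddfD /= bdK addr0.
apply: indv; have -> : \sum_i v i *~ c i =
    \sum_i (v i + bd (w i)) *~ c i - \sum_i bd (w i) *~ c i.
  by rewrite -sumrB; apply: eq_bigr => l _; rewrite mulrzDl addrK.
apply: (bnd_subgroup _ _).2; first exact: bndS Fc.
apply: subgroup_sum => [|l _]; first exact: bnd_subgroup.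
apply: subgroupMz; first exact: bnd_subgroup.
by exists (w l) => //; case: (wP l).
Qed.

(** An independent family of cycles is carried by a finite closed [F] and stays independent in the
    homology of [F], where fewer chains bound. This covers degrees with infinitely many critical
    elements. *)
Lemma indep_finite k j (v : 'I_j -> {freeg seq P}) :
  indep (cyc k [set: P]) (bnd k [set: P]) v ->
  exists F, finite_set F /\ (j <= ncritical k F)%N.
Proof.
move=> [vT indv].
have /choice[A AP] i : exists A, finite_set A /\ chainsn k.+1 A (v i).
  exact: finite_chain_support (vT i).1.
have fA : finite_set (\bigcup_(i in [set: 'I_j]) A i).
  by apply: bigcup_finite => [|i _]; [exact: finite_finset | case: (AP i)].
have [F [fF cF AF]] := closure_finite gP fP acP matchM wfM fA.
exists F; split=> //; have [beta [e [hF _ ->]]] := morse_count_finite fF cF.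
rewrite -addnA; apply: leq_trans (leq_addr _ _).
apply: (has_rank_ge (v := v) (hF k)); split=> [i|c Fc i].
  split; last exact: (vT i).2.
  by apply: chainsnS (AP i).2 => z Az; apply: AF; exists i.
by apply: indv; apply: bndS Fc.
Qed.

End Core.

(** * Comparison with [homology] *)

Section Bridge.
Context {d : Order.disp_t} {P : porderType d}.
Implicit Types (A : set P).

Lemma freegUE (K : choiceType) (k : int) (s : K) : << k *g s >> = << s >> *~ k :> {freeg K}.
Proof. by rewrite freegU_mulz intz. Qed.

Lemma delE (s : seq P) :del s =
  \sum_(i < size s) << (-1) ^+ i *g take i s ++ drop i.+1 s >>.
Proof.
elim: s => [|x s IHs]; first by rewrite /= big_ord0.
rewrite /= big_ord_recl /= drop0; congr (_ + _).
rewrite IHs raddf_sum -sumrN; apply: eq_bigr => i _ /=.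
rewrite freegUE raddfMz /= coneU -freegUE /bump /= add1n exprS mulN1r.
by rewrite -freegUN.
Qed.

(** The reversal passes from increasing lists to the decreasing ones of the augmented complex. *)
Definition embed A n : {freeg simplex A n} -> {freeg seq P} :=
  fglift (fun s : simplex A n => << rev (val s) >>).
HB.instance Definition _ A n :=
  GRing.isZmodMorphism.Build _ _ (@embed A n) (lift_is_additive _).

Lemma embedU A n (s : simplex A n) : embed << s >> = << rev (val s) >>.
Proof. exact: lift1. Qed.

Lemma simplex_chain A n (s : simplex A n) : chain A (rev (val s)) /\ size (rev (val s)) = n.+1.
Proof.
case: s => s /= /and3P[/eqP sn ss /allP sA]; rewrite size_rev; split=> //.
by split=> [|x]; [rewrite rev_sorted | rewrite mem_rev => /sA; rewrite inE].
Qed.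

Lemma embed_chainsn A n (c : {freeg simplex A n}) : chainsn n.+1 A (embed c).
Proof.
have : @supported (simplex A n) setT c by [].
move: c; apply: (@supported_ind _ _ [set c | chainsn n.+1 A (embed c)]).
  split=> [|c c' Ac Ac'] /=.
    by rewrite raddf0; apply: (chainsn_subgroup _ _).1.
  by rewrite raddfB; apply: (chainsn_subgroup _ _).2.
by move=> s _ /=; rewrite embedU; apply: supported1; apply: simplex_chain.
Qed.

Lemma coeff_embed A n (s : simplex A n) c : coeff (rev (val s)) (embed c) = coeff s c.
Proof.
move: c; apply: additive_ext => [u v|u v|t]; try by rewrite !raddfB.
by rewrite embedU !coeffU (inj_eq (can_inj revK)) (inj_eq val_inj).
Qed.

Lemma embed_inj A n : injective (@embed A n).
Proof. by move=> c c' cc'; apply: freegP => s; rewrite -!coeff_embed cc'. Qed.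

Lemma embed_onto A n u : chainsn n.+1 A u -> exists c : {freeg simplex A n}, embed c = u.
Proof.
apply: (@supported_ind _ _ [set u | exists c : {freeg simplex A n}, embed c = u]).
  split=> [|_ _ [c <-] [c' <-]]; first by exists 0; rewrite raddf0.
  by exists (c - c'); rewrite raddfB.
move=> s [[ss sA] sn] /=.
have rs : is_simplex A n (rev s).
  rewrite /is_simplex size_rev sn eqxx rev_sorted ss /=.
  by apply/allP => x; rewrite mem_rev inE => /sA.
by exists << exist (is_simplex A n) _ rs >>; rewrite embedU /= revK.
Qed.

(** Reversal turns face [i] into face [n.+1 - i], so the two boundaries differ by the global sign
    [(-1) ^+ n.+1], which affects neither cycles nor boundaries. *)
Lemma bd_embed A n (c : {freeg simplex A n.+1}) :
  bd (embed c) = embed (boundary c) *~ (-1) ^+ n.+1.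
Proof.
move: c; apply: additive_ext => [u v|u v|s]; first by rewrite !raddfB.
  by rewrite !raddfB /= mulrzBl.
have sn : size (val s) = n.+2 by case: (valP s) => /and3P[/eqP].
rewrite embedU bdU delE /boundary lift1 raddf_sum mulrz_suml size_rev sn.
rewrite (reindex_inj rev_ord_inj) /=; apply: eq_bigr => i _.
have i_le : (i <= n.+1)%N by rewrite -ltnS.
rewrite [in RHS]freegUE raddfMz /= embedU -freegUE freeg_mulz mulrzz /=.
rewrite take_rev drop_rev sn !subSS -rev_cat; congr << _ *g rev (_ ++ _) >>.
- by rewrite -[X in _ = _ * _ ^+ X](subnK i_le) exprD mulrCA -expr2 sqrr_sign mulr1.
- by congr take; lia.
- by congr drop; lia.
Qed.

Lemma embed_cyc A n (c : {freeg simplex A n}) : is_cycle c <-> cyc n A (embed c).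
Proof.
case: n c => [|n] c.
  split=> // _; split; first exact: embed_chainsn.
  have := chainsn_bd (@embed_chainsn A 0 c).
  by apply: supported_sub => s [_ /size0nil ->]; split.
split=> [/eqP c0|/cyc_bd].
  apply: bd_cyc; first exact: embed_chainsn.
  by rewrite bd_embed c0 raddf0 mul0rz.
rewrite bd_embed => /(congr1 (fun u => u *~ (-1) ^+ n.+1)).
rewrite mul0rz -mulrzA -expr2 sqrr_sign mulr1z => c0.
by apply/eqP; apply: embed_inj; rewrite c0 raddf0.
Qed.

Lemma embed_bnd A n (z : cycles A n) : is_boundary z <-> bnd n A (embed (val z)).
Proof.
split=> [/asboolP[c cz]|[w Aw wz]].
  exists (embed (c *~ (-1) ^+ n.+1)); first exact: embed_chainsn.
  rewrite bd_embed raddfMz /= cz raddfMz /= -mulrzA -expr2 sqrr_sign.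
  by rewrite mulr1z.
have [c cw] := embed_onto Aw; apply/asboolP; exists (c *~ (-1) ^+ n.+1).
by apply: embed_inj; rewrite raddfMz /= raddfMz /= -bd_embed cw.
Qed.

Lemma homology_pi0 A n (z : cycles A n) :
  (\pi_(Quotient.quot (@is_boundary _ _ A n)) z = 0)%qT <-> bnd n A (embed (val z)).
Proof.
have E : (is_boundary z = (\pi_(Quotient.quot (@is_boundary _ _ A n)) z == 0))%qT.
  rewrite -[LHS]/(z \in @is_boundary _ _ A n) -[z in LHS]subr0 Quotient.idealrBE.
  by rewrite raddf0.
by rewrite -embed_bnd E; split=> /eqP.
Qed.

Lemma homology_relation A n k (z : 'I_k -> cycles A n) (c : 'I_k -> int) :
  (\sum_i (\pi_(Quotient.quot (@is_boundary _ _ A n)) (z i)) *~ c i = 0)%qT <->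
  bnd n A (\sum_i embed (val (z i)) *~ c i).
Proof.
have <- : (\pi_(Quotient.quot (@is_boundary _ _ A n)) (\sum_i z i *~ c i) =
    \sum_i (\pi_(Quotient.quot (@is_boundary _ _ A n)) (z i)) *~ c i)%qT.
  by rewrite raddf_sum; apply: eq_bigr => i _; rewrite raddfMz.
have -> : \sum_i embed (val (z i)) *~ c i = embed (val (\sum_i z i *~ c i)).
  rewrite !raddf_sum; apply: eq_bigr => i _.
  have valM : val (z i *~ c i) = val (z i) *~ c i by exact: raddfMz.
  by rewrite -[RHS]/(embed (val (z i *~ c i))) valM raddfMz.
exact: homology_pi0.
Qed.

Lemma Zindep_homology n A k :
  (exists v : 'I_k -> homology A n, Zindep v) <->
  (exists v, indep (cyc n A) (bnd n A) (k := k) v).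
Proof.
split=> -[v].
  move=> indv; exists (fun i => embed (val (repr (v i)))).
  split=> [i|c /homology_relation c0]; first exact/embed_cyc/(valP (repr (v i))).
  apply: indv; rewrite -[RHS]c0.
  by apply: eq_bigr => i _; rewrite reprK.
move=> [cyc_v indv].
have /choice[z zE] i : exists z : cycles A n, embed (val z) = v i.
  have [c cv] := embed_onto (cyc_v i).1.
  have cc : is_cycle c by apply/embed_cyc; rewrite cv.
  by exists (exist _ c cc).
exists (fun i => \pi_(Quotient.quot (@is_boundary _ _ A n)) (z i))%qT.
move=> c /homology_relation c0; apply: indv.
by move: c0; under eq_bigr => i _ do rewrite zE.
Qed.

Lemma proj_sum (u : {freeg seq P}) : exists m, u = \sum_(k < m) proj k u.
Proof.
exists (\max_(s <- dom u) size s).+1; apply: freegP => s; rewrite raddf_sum /=.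
under eq_bigr => k _ do rewrite coeff_proj.
have [us|us] := eqVneq (coeff s u) 0.
  by rewrite us big1 // => k _; case: ifP.
have sm : (size s < (\max_(s <- dom u) size s).+1)%N.
  by rewrite ltnS; apply: leq_bigmax_seq => //; rewrite mem_dom.
rewrite (bigD1 (Ordinal sm)) //= eqxx big1 ?addr0 // => k ks.
by case: eqP => // sk; case/eqP: ks; apply: val_inj.
Qed.

Lemma bd_edge A x y : A x -> A y -> (x >=< y)%O ->
  exists2 g, chains A g & bd g = << [:: y] >> - << [:: x] >>.
Proof.
wlog xy : x y / (x <= y)%O => [hw|] Ax Ay.
  move=> /orP[xy|yx]; first by apply: hw => //; rewrite le_comparable.
  have [|g Ag bg] := hw _ _ yx Ay Ax; first exact: le_comparable.
  exists (- g); first exact: (subgroupN (chains_subgroup _)).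
  by rewrite raddfN /= bg opprB.
move=> _; have [->|nxy] := eqVneq x y.
  by exists 0; rewrite ?raddf0 ?subrr //; apply: (chains_subgroup _).1.
have lt_xy : (x < y)%O by rewrite lt_neqAle nxy.
exists (- << [:: y; x] >>).
  apply: (subgroupN (chains_subgroup _)); apply: supported1.
  by apply/chain_cons; split=> //; apply/chain_cons; split.
by rewrite raddfN /= bdU /= [cone x 0]raddf0 subr0 coneU opprB.
Qed.

Lemma bd_path A x s : A x -> {subset s <= A} -> path >=<%O x s ->
  exists2 g, chains A g & bd g = << [:: last x s] >> - << [:: x] >>.
Proof.
elim: s x => [|y s IHs] x Ax sA /=.
  by exists 0; rewrite ?raddf0 ?subrr //; apply: (chains_subgroup _).1.
have Ay : A y by have := sA y; rewrite !inE eqxx => /(_ isT).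
case/andP=> xy ys; have [g Ag bg] := bd_edge Ax Ay xy.
have [|h Ah bh] := IHs y Ay _ ys; first by move=> z zs; apply: sA; rewrite inE zs orbT.
exists (g + h); first exact: (subgroupD (chains_subgroup _)).
by rewrite raddfD /= bg bh addrC addrA subrK.
Qed.

(** By size of the chains: a point of [A] bounds the empty chain, connectedness deals with points,
    and from edges on reduced and unreduced homology agree. *)
Lemma acyclic_homology A : A !=set0 -> connected_complex A ->
  (forall n (h : homology A n.+1), h = 0) -> acyclic A.
Proof.
move=> [p Ap] conn hom0 u Au u0.
have sA := chains_subgroup A.
suff /choice[g gP] k : exists g, chains A g /\ bd g = proj k u.
  have [m uE] := proj_sum u; exists (\sum_(k < m) g k).
    by apply: subgroup_sum => // k _; case: (gP k).
  by rewrite raddf_sum [RHS]uE; apply: eq_bigr => k _; case: (gP k).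
have Auk := @proj_chains _ _ k A u Au.
case: k Auk => [|[|k]] Auk.
- exists (cone p (proj 0 u)); split; last by rewrite bd_cone (chainsn0_bd Auk) raddf0 subr0.
  apply: chains_cone => //; move: Auk; apply: supported_sub => s [_ /size0nil ->].
  by split.
- have [g Ag [m mE]] : exists2 g, chains A g &
      exists m : int, proj 1 u = bd g + << [:: p] >> *~ m.
    move: Auk; apply: (@supported_ind _ _ [set u | exists2 g, chains A g &
      exists m : int, u = bd g + << [:: p] >> *~ m]).
      split=> [|_ _ [g Ag [m ->]] [h Ah [l ->]]].
        by exists 0; [exact: sA.1 | exists 0; rewrite raddf0 mulr0z addr0].
      exists (g - h); first exact: sA.2.
      by exists (m - l); rewrite raddfB mulrzBr opprD addrACA.
    move=> [|q [|? ?]] [qA] // _.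
    have Aq : A q by apply: qA.2; rewrite inE.
    have [s ss [ps sq]] := conn p q Ap Aq; have [g Ag bg] := bd_path Ap ss ps.
    by exists g => //; exists 1; rewrite bg sq mulr1z subrK.
  (* The integer [m] is the augmentation of [proj 1 u], read off as the coefficient of the empty
     chain in its boundary; it vanishes because [u] is a cycle. *)
  exists g; split=> //; suff m0 : m = 0 by rewrite mE m0 mulr0z addr0.
  have := congr1 (coeff [::]) (congr1 (@bd _ P) mE).
  rewrite proj_bd u0 raddf0 coeff0 raddfD /= bdK add0r raddfMz /= bdU /= raddf0 subr0.
  by rewrite -freegUE coeffU eqxx mulr1.
suff [v Av bv] : bnd k.+1 A (proj k.+2 u).
  by exists v; split=> //; apply: chainsn_chains Av.
have cu : cyc k.+1 A (proj k.+2 u) by apply: bd_cyc => //; rewrite proj_bd u0 raddf0.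
have [c cuE] := embed_onto Auk.
have cc : is_cycle c by apply/embed_cyc; rewrite cuE.
have /homology_pi0 := hom0 k (\pi_(Quotient.quot (@is_boundary _ _ A k.+1))
  (exist (@is_cycle _ _ A k.+1) c cc))%qT.
by rewrite /= cuE.
Qed.

End Bridge.

(** * The Morse inequalities *)

Section RankCard.

Definition Zindep_size (A : zmodType) k := exists v : 'I_k -> A, Zindep v.

Lemma rank_le (A : zmodType) (x : \bar int) :
  (forall k, Zindep_size A k -> (k%:Z%:E <= x)%E) -> (rank A <= x)%E.
Proof.
move=> kx; rewrite /rank /supremum; case: ifP => _; first exact: leNye.
case: xgetP => [y _ [_ lby]|_]; last exact: leNye.
by apply: lby => _ [k Ak <-]; apply: kx.
Qed.

Lemma rank_eq (A : zmodType) r :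
  Zindep_size A r -> (forall k, Zindep_size A k -> (k <= r)%N) -> rank A = r%:Z%:E.
Proof.
move=> Ar maxr; apply/eqP; rewrite eq_le rank_le /=; last first.
  by move=> k /maxr; rewrite lee_fin lez_nat.
apply: ge_supremum_Nmem; last by exists r.
exists r%:Z%:E; split; last by move=> x; apply; exists r.
by move=> _ [k /maxr kr <-]; rewrite lee_fin lez_nat.
Qed.

Lemma rank_bounded (A : zmodType) K : (forall k, Zindep_size A k -> (k <= K)%N) ->
  exists2 r, (r <= K)%N & rank A = r%:Z%:E.
Proof.
move=> AK; pose Q k := `[< Zindep_size A k >].
have Q0 : exists k, Q k by exists 0%N; apply/asboolP; exists (fun=> 0) => c _ [].
have QK k : Q k -> (k <= K)%N by move=> /asboolP/AK.
have [r /asboolP Ar maxr] := ex_maxnP Q0 QK.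
by exists r; [exact: AK | apply: rank_eq => // k Ak; apply/maxr/asboolP].
Qed.

Lemma ecard_finite (T : choiceType) (A : set T) :
  finite_set A -> ecard A = #|` fset_set A|%:Z%:E.
Proof. by move=> fA; rewrite /ecard asboolT. Qed.

Lemma ecard_infinite (T : choiceType) (A : set T) : ~ finite_set A -> ecard A = +oo%E.
Proof. by move=> fA; rewrite /ecard asboolF. Qed.

Lemma ecard_fin_num (T : choiceType) (A : set T) : ecard A \is a fin_num -> finite_set A.
Proof. by move=> fA; apply: contrapT => /ecard_infinite A_oo; rewrite A_oo in fA. Qed.

Lemma ecardU (T : choiceType) (A B : set T) : A `&` B = set0 -> finite_set B ->
  ecard (A `|` B) = (ecard A + ecard B)%E.
Proof.
move=> AB fB; have [fA|nfA] := pselect (finite_set A); last first.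
  rewrite (ecard_infinite nfA) (ecard_finite fB) ecard_infinite //.
  by rewrite finite_setU => -[].
rewrite !ecard_finite //; last by rewrite finite_setU.
by rewrite fset_setU // -EFinD -PoszD -cardfsUI -fset_setI // AB fset_set0 cardfs0 addn0.
Qed.

Lemma ecard_image (T U : choiceType) (f : T -> U) (A : set T) :
  {in A &, injective f} -> finite_set A -> ecard (f @` A) = ecard A.
Proof.
move=> f_inj fA; rewrite !ecard_finite //; last exact: finite_image.
rewrite fset_set_image //; congr (EFin (Posz _)).
apply/eqP/card_in_imfsetP => x y; rewrite !in_fset_set //; exact: f_inj.
Qed.

Lemma ecard_set0 (T : choiceType) : ecard (set0 : set T) = 0%E.
Proof. by rewrite ecard_finite ?fset_set0 ?cardfs0. Qed.

Lemma ecard_eq0 (T : choiceType) (A : set T) : ecard A = 0%E -> A = set0.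
Proof.
have [fA|nfA] := pselect (finite_set A); last by rewrite ecard_infinite.
by rewrite ecard_finite // => -[/cardfs0_eq]; apply: fset_set_set0.
Qed.

End RankCard.

Section AlternatingSums.

Lemma alternating_telescope (e : nat -> nat) N : e 0%N = 0%N ->
  \sum_(i < N.+1) (-1) ^+ (N - i) * (e i + e i.+1)%:Z = (e N.+1)%:Z :> int.
Proof.
move=> e0; elim: N => [|N IHN]; first by rewrite big_ord1 e0 subn0 expr0 mul1r.
rewrite big_ord_recr /= subnn expr0 mul1r.
have -> : \sum_(i < N.+1) (-1) ^+ (N.+1 - i) * (e i + e i.+1)%:Z = - (e N.+1)%:Z :> int.
  rewrite -IHN -sumrN; apply: eq_bigr => i _.
  by rewrite subSn ?exprS ?mulN1r ?mulNr //; case: i.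
by rewrite PoszD addrA addNr add0r.
Qed.

Lemma alternating_signs (f : nat -> int) N :
  \sum_(i < N.+1) (-1) ^+ i * f i = (-1) ^+ N * \sum_(i < N.+1) (-1) ^+ (N - i) * f i.
Proof.
rewrite mulr_sumr; apply: eq_bigr => i _; rewrite mulrA; congr (_ * _).
have iN : (i <= N)%N by case: i.
by rewrite -exprD -[RHS]signr_odd oddD oddB // addKb signr_odd.
Qed.

End AlternatingSums.

Section ReversalCount.
Context {d : Order.disp_t} {P : porderType d}.

Lemma reversal_count (M : set (P * P)) : graded P -> finite_principal_ideals P ->
  morse_matching M -> finite_set (ray_classes M) ->
  exists M' : set (P * P), [/\ matching M', well_founded (fun y x => marrow M' x y) &
    forall n, ecard (criticals M' n) = (num_critical M n + num_rays M n)%E].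
Proof.
move=> gP fP morseM finR.
(* [r0] serves as the value of [rho] on sets that are not ray classes; without any ray, [M] itself
   will do. *)
have [[r0 rr0]|noray] := pselect (exists r, ray M r); last first.
  exists M; split; first by case: morseM.
    apply: no_walk_well_founded => s /(walk_ray morseM) rs; apply: noray.
    by exists s.
  move=> n; rewrite /num_rays (_ : [set r | _] = set0) ?image_set0 ?ecard_set0 ?adde0 //.
  by apply/seteqP; split=> // r [rr _]; apply: noray; exists r.
have /choice[rho rhoP] C : exists r, ray_classes M C -> tame M C r.
  have [/(tame_exists gP fP morseM finR)[r ?]|nC] := pselect (ray_classes M C).
    by exists r.
  by exists r0.
exists (reversal M rho); split.
- exact: (reversal_matching morseM rhoP).
- exact/no_walk_well_founded/(reversal_no_walk morseM finR rhoP).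
move=> n; pose D := [set C | ray_classes M C /\ degree (rho C 0%N) = n].
have fD : finite_set D by apply: sub_finite_set finR => C [].
have raysE : [set ray_class M r | r in [set r | ray M r /\ ray_degree r n]] = D.
  apply/seteqP; split=> [_ [r [rr rn] <-]|C [RCC Cn]].
    have RCr : ray_classes M (ray_class M r) by exists r.
    have tr := rhoP _ RCr; split=> //.
    have eq_r : ray_equiv r (rho (ray_class M r)).
      by apply: (ray_classP (tame_ray tr)); rewrite (tame_class tr).
    apply/eqP; rewrite eqn_leq.
    rewrite (ray_degree_le gP fP morseM rr (ray_equiv_sym eq_r) (tame_degree tr) rn).
    exact: (ray_degree_le gP fP morseM (tame_ray tr) eq_r rn (tame_degree tr)).
  have tC := rhoP _ RCC; exists (rho C); last exact: tame_class tC.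
  by split; [exact: tame_ray tC | rewrite -Cn; exact: tame_degree tC].
rewrite /num_rays raysE -(@ecard_image _ _ (fun C => rho C 0%N) D) //; last first.
  move=> C C'; rewrite !inE => -[RCC _] [RCC' _].
  by move=> /(tame_disjoint rhoP RCC RCC')[].
rewrite /num_critical -ecardU; last exact: finite_image.
  congr ecard; apply/seteqP; split=> x.
    move=> [/(reversal_critical morseM rhoP)[xc|[C RCC Cx]] xn]; first by left.
    by right; exists C => //; split; rewrite ?Cx.
  move=> [[xc xn]|[C [RCC Cn] Cx]].
    by split=> //; apply/(reversal_critical morseM rhoP); left.
  by split; [apply/(reversal_critical morseM rhoP); right; exists C | rewrite -Cx].
apply/seteqP; split=> // x [[xc _] [C [RCC _] Cx]].
by apply: (tame_start_matched rhoP RCC); rewrite Cx.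
Qed.

End ReversalCount.

Lemma finite_nat_bound (A : set nat) : finite_set A ->
  exists K, forall n, A n -> (n < K)%N.
Proof.
move=> /finite_seqP[s sE]; exists (\max_(n <- s) n).+1 => n An; rewrite ltnS.
by apply: leq_bigmax_seq => //; move: An; rewrite sE.
Qed.

Section MorseInequalities.
Context {d : Order.disp_t} {P : porderType d}.

Lemma admissible_acyclic : homologically_admissible P ->
  forall x y : P, hasse x y -> acyclic (sdown x `\ y).
Proof.
move=> [_ _ hP] x y [yx noz]; have [] : maximal_of (sdown x) y.
  split=> // z zx yz; apply: contrapT => /eqP zy; apply: noz; exists z.
  by rewrite zx lt_neqAle eq_sym zy yz.
move=> sxy maxy; have [A0 A1 A2] := hP x y (conj sxy maxy).
exact: acyclic_homology.
Qed.

Context (gP : graded P) (fP : finite_principal_ideals P).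
Context (acP : forall x y : P, hasse x y -> acyclic (sdown x `\ y)).
Context (M : set (P * P)) (matchM : matching M).
Context (wfM : well_founded (fun y x => marrow M x y)).

Lemma betti_le_criticals n : (betti P n <= ecard (criticals M n))%E.
Proof.
apply: rank_le => k /Zindep_homology[v /(indep_finite gP fP acP matchM wfM)[F [fF kF]]].
have [fn|nfn] := pselect (finite_set (criticals M n)); last first.
  by rewrite ecard_infinite // leey.
rewrite ecard_finite // lee_fin lez_nat; apply: leq_trans kF _.
have fFn : finite_set (F `&` criticals M n) by exact: finite_setIl.
by apply: fsubset_leq_card; rewrite -fset_set_sub // => z [].
Qed.

(** Knowing all critical elements of degree [k] bounds the Betti number by that of the finite piece;
    knowing those of degree [k.+1] too gives equality. *)
Lemma morse_count_exists (A : set P) : finite_set A -> exists beta e : nat -> nat,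
  e 0%N = 0%N /\ forall k, criticals M k `<=` A ->
    [/\ ecard (criticals M k) = (beta k + e k + e k.+1)%N%:Z%:E,
        exists2 b, (b <= beta k)%N & betti P k = b%:Z%:E &
        criticals M k.+1 `<=` A -> betti P k = (beta k)%:Z%:E].
Proof.
move=> fA; have [F [fF cF AF]] := closure_finite gP fP acP matchM wfM fA.
have [beta [e [hF e0 cE]]] := morse_count_finite gP fP acP matchM wfM fF cF.
exists beta, e; split=> // k /subset_trans/(_ AF) kF.
have bound j : Zindep_size (homology [set: P] k) j -> (j <= beta k)%N.
  by move=> /Zindep_homology[v]; apply: (indep_setT_bound gP fP acP matchM wfM cF fF kF (hF k)).
split.
- rewrite -cE ecard_finite; last exact: sub_finite_set fF.
  by rewrite /ncritical setIC (setIidl kF).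
- exact: rank_bounded.
- move=> /subset_trans/(_ AF) kF1; apply: rank_eq => //; apply/Zindep_homology.
  by have [] := hrank_setT gP fP acP matchM wfM cF fF kF kF1 (hF k).
Qed.

Lemma strong_morse N : (forall i, (i <= N)%N -> finite_set (criticals M i)) ->
  (\sum_(i < N.+1) ((-1) ^+ (N - i))%R%:E * betti P i
     <= \sum_(i < N.+1) ((-1) ^+ (N - i))%R%:E * ecard (criticals M i))%E.
Proof.
move=> fin; have fA : finite_set (\bigcup_(i in `I_N.+1) criticals M i).
  by apply: bigcup_finite => // i iN; apply: fin.
have [beta [e [e0 bE]]] := morse_count_exists fA.
have subA i : (i < N.+1)%N -> criticals M i `<=` \bigcup_(i in `I_N.+1) criticals M i.
  by move=> iN z zi; exists i.
have [_ [b bN bettiN] _] := bE N (subA N (ltnSn N)).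
(* Degree [N.+1] may have infinitely many critical elements, so in degree [N] only [b <= beta N] is
   known; this goes the right way, since the sign there is positive. *)
pose b' i := if i == N then b else beta i.
have bettiE i : (i < N.+1)%N -> betti P i = (b' i)%:Z%:E.
  move=> iN; rewrite /b'; case: eqP => [->//|/eqP ne_iN].
  have [_ _] := bE i (subA i iN); apply; apply: subA.
  by rewrite ltnS ltn_neqAle ne_iN -ltnS.
rewrite (eq_bigr (fun i : 'I_N.+1 => ((-1) ^+ (N - i) * (b' i)%:Z)%:E)) => [|i _]; last first.
  by rewrite bettiE.
rewrite [leRHS](eq_bigr (fun i : 'I_N.+1 =>
    ((-1) ^+ (N - i) * (beta i)%:Z + (-1) ^+ (N - i) * (e i + e i.+1)%:Z)%:E)) => [|i _]; last first.
  by have [-> _ _] := bE i (subA i (ltn_ord i)); rewrite -EFinM -mulrDr -PoszD addnA.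
rewrite !sumEFin lee_fin big_split /= alternating_telescope //.
rewrite !big_ord_recr /= subnn !expr0 !mul1r {2}/b' eqxx.
rewrite (eq_bigr (fun i : 'I_N => (-1) ^+ (N - i) * (beta i)%:Z)) => [|i _]; last first.
  by rewrite /b' ltn_eqF.
by rewrite -addrA lerD2l -PoszD lez_nat (leq_trans bN) ?leq_addr.
Qed.

Lemma euler_morse : (forall i, finite_set (criticals M i)) ->
  finite_set [set i | criticals M i !=set0] ->
  (\sum_(i \in [set: nat]) ((-1) ^+ i)%R%:E * betti P i
     = \sum_(i \in [set: nat]) ((-1) ^+ i)%R%:E * ecard (criticals M i))%E.
Proof.
move=> fin /finite_nat_bound[K KP].
have noc i : (K <= i)%N -> criticals M i = set0.
  move=> Ki; apply/seteqP; split=> // z zi.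
  by have := KP i (ex_intro _ z zi); rewrite ltnNge Ki.
have fA : finite_set (\bigcup_(i in `I_K) criticals M i).
  by apply: bigcup_finite => // i iN; apply: fin.
have [beta [e [e0 bE]]] := morse_count_exists fA.
have subA i : criticals M i `<=` \bigcup_(i in `I_K) criticals M i.
  move=> z zi; exists i => //; apply: KP; by exists z.
have cE i : ecard (criticals M i) = (beta i + e i + e i.+1)%N%:Z%:E by case: (bE i (subA i)).
have bettiE i : betti P i = (beta i)%:Z%:E by case: (bE i (subA i)) => _ _; apply.
have zero i : (K <= i)%N -> (beta i + e i + e i.+1 = 0)%N.
  by move=> /noc Ki; have := cE i; rewrite Ki ecard_set0 => -[].
(* With [K.+1] terms the range is never empty, and the remainder of the telescoping sum is [e K.+1],
   which is zero. *)
have sumK (f : nat -> \bar int) : (forall i, (K <= i)%N -> f i = 0%E) ->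
    (\sum_(i \in [set: nat]) f i = \sum_(i < K.+1) f i)%E.
  move=> f0; rewrite fsbig_ord; apply/esym/fsbig_widen => // i [_ /= /negP].
  by rewrite -leqNgt => /ltnW; apply: f0.
rewrite !sumK => [|i /zero i0|i /zero i0]; last 2 first.
- by rewrite cE i0 mule0.
- by rewrite bettiE (_ : beta i = 0%N) ?mule0 //; move: i0; lia.
rewrite (eq_bigr (fun i : 'I_K.+1 => ((-1) ^+ i * (beta i)%:Z)%:E)) => [|i _]; last first.
  by rewrite bettiE.
rewrite [RHS](eq_bigr (fun i : 'I_K.+1 =>
    ((-1) ^+ i * (beta i)%:Z + (-1) ^+ i * (e i + e i.+1)%:Z)%:E)) => [|i _]; last first.
  by rewrite cE -EFinM -mulrDr -PoszD addnA.
rewrite !sumEFin big_split /= (alternating_signs (fun i => (e i + e i.+1)%:Z)).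
rewrite alternating_telescope //.
by have -> : e K.+1 = 0%N; [have := zero K (leqnn K); lia | rewrite mulr0 addr0].
Qed.

End MorseInequalities.

Local Open Scope ereal_scope.

Theorem corollary5p4 (d : Order.disp_t) (P : porderType d) (M : set (P * P)) :
  homologically_admissible P ->
  morse_matching M ->
  finite_set (ray_classes M) ->
  let m := num_critical M in
  let r := num_rays M in
  let b := betti P in
  forall N : nat,
  [/\ (forall i, (i <= N)%N -> m i \is a fin_num) ->
      \sum_(i < N.+1) ((-1) ^+ (N - i))%R%:E * b i
        <= \sum_(i < N.+1) ((-1) ^+ (N - i))%R%:E * (m i + r i),
      b N <= m N + r N
    & (forall i, m i \is a fin_num) -> finite_set [set i | m i != 0] ->
      \sum_(i \in [set: nat]) ((-1) ^+ i)%R%:E * b i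
        = \sum_(i \in [set: nat]) ((-1) ^+ i)%R%:E * (m i + r i)].
Proof.
move=> hP morseM finR m r b N; have acP := admissible_acyclic hP.
have [gP fP _] := hP.
have [M' [matchM' wfM' cE]] := reversal_count gP fP morseM finR.
have fin_rays i : finite_set [set ray_class M s | s in [set s | ray M s /\ ray_degree s i]].
  by apply: sub_finite_set finR => _ [s [rs _] <-]; exists s.
have fin_criticals i : m i \is a fin_num -> finite_set (criticals M' i).
  move=> mi; apply: ecard_fin_num; rewrite cE fin_numD mi /=.
  by rewrite /num_rays ecard_finite.
(* Finitely many classes have finitely many degrees, so [M'] too has critical elements in only
   finitely many degrees. The default 0 is never met on a ray class. *)
pose degree_of C := xget 0%N
  [set i | exists s, [/\ ray M s, ray_class M s = C & ray_degree s i]].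
split.
- move=> mN; rewrite [leRHS](eq_bigr (fun i : 'I_N.+1 =>
    ((-1) ^+ (N - i))%R%:E * ecard (criticals M' i))) => [|i _]; last by rewrite cE.
  apply: (strong_morse gP fP acP matchM' wfM') => i iN.
  exact/fin_criticals/mN.
- by rewrite -cE; apply: betti_le_criticals.
- move=> mfin m0; rewrite [RHS](eq_fsbigr (fun i =>
    ((-1) ^+ i)%R%:E * ecard (criticals M' i))) => [|i _]; last by rewrite cE.
  apply: (euler_morse gP fP acP matchM' wfM') => [i|]; first exact/fin_criticals/mfin.
  apply: (@sub_finite_set _ _ ([set i | m i != 0] `|`
      [set degree_of C | C in ray_classes M])); last first.
    by rewrite finite_setU; split=> //; apply: finite_image.
  move=> i /set0P/eqP ci; have [mi0|] := eqVneq (m i) 0; last by left.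
  right; apply: contrapT => nor; apply: ci; apply: ecard_eq0.
  rewrite cE -/(m i) mi0 add0e /num_rays (_ : [set _ | _ in _] = set0) ?ecard_set0 //.
  apply/seteqP; split=> // C [s [rs si] _]; apply: nor.
  exists (ray_class M s); first by exists s.
  rewrite /degree_of; case: xgetP => [j _ [t [rt ts tj]]|/(_ i)[]]; last by exists s.
  have t_s := ray_classP rs ts; have s_t := ray_equiv_sym t_s.
  apply/eqP; rewrite eqn_leq (ray_degree_le gP fP morseM rs t_s tj si).
  exact: (ray_degree_le gP fP morseM rt s_t si tj).
Qed.
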